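(* Let $\sigma_1,\dots,\sigma_N$ be mutually orthogonal density matrices on $\mathcal{H}$, $D=\dim\mathcal{H}$, with supports $s_1,\dots,s_N$, and suppose they are perfectly distinguishable by LOCC. Then for any unit vectors $|\psi_i\rangle\in s_i$ ($i=1,\dots,N$), $$N\le \frac{D}{\overline{1+R(|\psi_i\rangle)}}\le\frac{D}{\overline{2^{E_R(|\psi_i\rangle)}}}\le\frac{D}{\overline{2^{E_g(|\psi_i\rangle)}}}.$$ In particular this holds for unit vectors $|\Psi_i\rangle\in s_i$ chosen with $R(|\Psi_i\rangle)=\max_{|\psi\rangle\in s_i,\ \||\psi\rangle\|=1}R(|\psi\rangle)$ for each $i$.
   Context: $\mathcal{H}=\mathcal{H}_1\otimes\cdots\otimes\mathcal{H}_m$ is finite-dimensional and shared by $m$ parties. Perfect LOCC distinguishability: there is an LOCC-implementable POVM $\{\Pi_i\}$ with $\mathrm{Tr}(\Pi_i\sigma_j)=\delta_{ij}$. The support of a density matrix is the span of its eigenvectors with nonzero eigenvalues. A state is (fully) separable if it is a convex combination of product states $\rho^{(1)}\otimes\cdots\otimes\rho^{(m)}$; $\mathfrak{S}$ denotes the set of separable states. For a state $\sigma$, the global robustness of entanglement is $R_g(\sigma)=\min\{t\ge0:\exists$ a density matrix $\varrho$ with $(\sigma+t\varrho)/(1+t)\in\mathfrak{S}\}$, and for a pure state $R(|\psi\rangle):=R_g(|\psi\rangle\langle\psi|)$. The relative entropy of entanglement is $E_R(\sigma)=\min_{\omega\in\mathfrak{S}}\mathrm{Tr}\,\sigma(\log_2\sigma-\log_2\omega)$,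 and $E_R(|\psi\rangle):=E_R(|\psi\rangle\langle\psi|)$. The geometric measure of a pure state is $E_g(|\psi\rangle)=-\log_2\max|\langle\phi|\psi\rangle|^2$, the maximum over unit product vectors $|\phi\rangle=|\phi_1\rangle\otimes\cdots\otimes|\phi_m\rangle$. For numbers $x_1,\dots,x_N$, $\overline{x_i}=\frac1N\sum_{i=1}^N x_i$. *)

(* Defs.v *)
From Stdlib Require Import Reals Lra Lia Arith.
Open Scope R_scope.

Record C := mkC { Re : R ; Im : R }.
Definition C0 : C := mkC 0 0.
Definition C1 : C := mkC 1 0.
Definition RC (x : R) : C := mkC x 0.
Definition Cadd (a b : C) : C := mkC (Re a + Re b) (Im a + Im b).
Definition Cmul (a b : C) : C :=
  mkC (Re a * Re b - Im a * Im b) (Re a * Im b + Im a * Re b).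
Definition Cconj (a : C) : C := mkC (Re a) (- Im a).
Definition Cnorm2 (a : C) : R := Re a * Re a + Im a * Im a.

Fixpoint Csum (n : nat) (f : nat -> C) : C :=
  match n with O => C0 | S n' => Cadd (Csum n' f) (f n') end.
Fixpoint Cprod (n : nat) (f : nat -> C) : C :=
  match n with O => C1 | S n' => Cmul (Cprod n' f) (f n') end.
Fixpoint Rsum (n : nat) (f : nat -> R) : R :=
  match n with O => 0 | S n' => Rsum n' f + f n' end.
Fixpoint Nprod (n : nat) (f : nat -> nat) : nat :=
  match n with O => 1%nat | S n' => (Nprod n' f * f n')%nat end.

(* ---------- vectors / matrices of dimension n (indices < n) ---------- *)
Definition Vec := nat -> C.
Definition Mat := nat -> nat -> C.

Definition mat_eq (n : nat) (A B : Mat) : Prop :=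
  forall i j, (i < n)%nat -> (j < n)%nat -> A i j = B i j.
Definition zerom : Mat := fun _ _ => C0.
Definition idm : Mat := fun i j => if Nat.eqb i j then C1 else C0.
Definition Msum (K : nat) (f : nat -> Mat) : Mat := fun i j => Csum K (fun a => f a i j).
Definition mmul (n : nat) (A B : Mat) : Mat :=
  fun i j => Csum n (fun k => Cmul (A i k) (B k j)).
Definition adj (A : Mat) : Mat := fun i j => Cconj (A j i).
Definition trace (n : nat) (A : Mat) : C := Csum n (fun i => A i i).
Definition apply (n : nat) (A : Mat) (v : Vec) : Vec :=
  fun i => Csum n (fun j => Cmul (A i j) (v j)).
Definition inner (n : nat) (u v : Vec) : C := Csum n (fun i => Cmul (Cconj (u i)) (v i)).
Definition outer (u v : Vec) : Mat := fun i j => Cmul (u i) (Cconj (v j)).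
Definition unitv (n : nat) (v : Vec) : Prop := inner n v v = C1.

Definition hermitian (n : nat) (A : Mat) : Prop :=
  forall i j, (i < n)%nat -> (j < n)%nat -> A i j = Cconj (A j i).
Definition psd (n : nat) (A : Mat) : Prop :=
  hermitian n A /\ forall v : Vec, 0 <= Re (inner n v (apply n A v)).
Definition density (n : nat) (A : Mat) : Prop := psd n A /\ trace n A = C1.

Definition in_support (n : nat) (s : Mat) (v : Vec) : Prop :=
  exists (K : nat) (c : nat -> C) (u : nat -> Vec),
    (forall j, (j < K)%nat -> exists lam : C, lam <> C0 /\
        forall i, (i < n)%nat -> apply n s (u j) i = Cmul lam (u j i)) /\
    forall i, (i < n)%nat -> v i = Csum K (fun j => Cmul (c j) (u j i)).

Definition eigendecomp (n : nat) (A : Mat) (mu : nat -> R) (u : nat -> Vec) : Prop :=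
  (forall k l, (k < n)%nat -> (l < n)%nat ->
     inner n (u k) (u l) = if Nat.eqb k l then C1 else C0) /\
  mat_eq n A (fun i j => Csum n (fun k => Cmul (RC (mu k)) (outer (u k) (u k) i j))).

Definition log2 (x : R) : R := ln x / ln 2.

(* rel_entropy n s w x : Tr s (log2 s - log2 w) is finite and equals x
   (convention 0 log 0 = 0; infinite when supp s is not inside supp w) *)
Definition rel_entropy (n : nat) (s w : Mat) (x : R) : Prop :=
  exists (mu : nat -> R) (u : nat -> Vec) (lam : nat -> R) (v : nat -> Vec),
    eigendecomp n s mu u /\ eigendecomp n w lam v /\
    (forall k l, (k < n)%nat -> (l < n)%nat -> 0 < mu k ->
        0 < Cnorm2 (inner n (u k) (v l)) -> 0 < lam l) /\
    x = Rsum n (fun k => if Rlt_dec 0 (mu k) then mu k * log2 (mu k) else 0)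
        - Rsum n (fun k => Rsum n (fun l =>
            if Rlt_dec 0 (lam l)
            then mu k * Cnorm2 (inner n (u k) (v l)) * log2 (lam l) else 0)).

(* ---------- multipartite structure: H = H_0 (x) ... (x) H_{m-1}, dim H_k = d k ---------- *)
Definition prodd (d : nat -> nat) (k : nat) : nat := Nprod k d.
Definition dimH (m : nat) (d : nat -> nat) : nat := prodd d m.
(* k-th local index of the global (mixed-radix) index i *)
Definition digit (d : nat -> nat) (i k : nat) : nat := ((i / prodd d k) mod d k)%nat.

Definition prodvec (m : nat) (d : nat -> nat) (phi : nat -> Vec) : Vec :=
  fun i => Cprod m (fun k => phi k (digit d i k)).
Definition prodmat (m : nat) (d : nat -> nat) (rho : nat -> Mat) : Mat :=
  fun i j => Cprod m (fun k => rho k (digit d i k) (digit d j k)).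
Definition lift (m : nat) (d : nat -> nat) (k : nat) (A : Mat) : Mat :=
  prodmat m d (fun l => if Nat.eqb l k then A else idm).

Definition separable (m : nat) (d : nat -> nat) (w : Mat) : Prop :=
  exists (K : nat) (p : nat -> R) (rho : nat -> nat -> Mat),
    (forall j, (j < K)%nat -> 0 <= p j) /\ Rsum K p = 1 /\
    (forall j k, (j < K)%nat -> (k < m)%nat -> density (d k) (rho j k)) /\
    mat_eq (dimH m d) w (fun a b => Csum K (fun j => Cmul (RC (p j)) (prodmat m d (rho j) a b))).

Definition Rg_feasible (m : nat) (d : nat -> nat) (s : Mat) (t : R) : Prop :=
  0 <= t /\ exists r : Mat, density (dimH m d) r /\
    separable m d (fun a b => Cmul (RC (/ (1 + t))) (Cadd (s a b) (Cmul (RC t) (r a b)))).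
Definition is_Rg (m : nat) (d : nat -> nat) (s : Mat) (r : R) : Prop :=
  Rg_feasible m d s r /\ forall t, Rg_feasible m d s t -> r <= t.
Definition is_R (m : nat) (d : nat -> nat) (psi : Vec) (r : R) : Prop :=
  is_Rg m d (outer psi psi) r.

Definition is_ER_state (m : nat) (d : nat -> nat) (s : Mat) (e : R) : Prop :=
  (exists w, density (dimH m d) w /\ separable m d w /\ rel_entropy (dimH m d) s w e) /\
  forall w x, density (dimH m d) w -> separable m d w ->
    rel_entropy (dimH m d) s w x -> e <= x.
Definition is_ER (m : nat) (d : nat -> nat) (psi : Vec) (e : R) : Prop :=
  is_ER_state m d (outer psi psi) e.

Definition is_Eg (m : nat) (d : nat -> nat) (psi : Vec) (e : R) : Prop :=
  exists g : R,
    (exists phi : nat -> Vec, (forall k, (k < m)%nat -> unitv (d k) (phi k)) /\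
       Cnorm2 (inner (dimH m d) (prodvec m d phi) psi) = g) /\
    (forall phi : nat -> Vec, (forall k, (k < m)%nat -> unitv (d k) (phi k)) ->
       Cnorm2 (inner (dimH m d) (prodvec m d phi) psi) <= g) /\
    e = - log2 g.

(* Node k K M next: party k performs a local measurement with Kraus/measurement
   operators M 0, ..., M (K-1) on H_k, broadcasts the outcome a, and the protocol
   continues with (next a).  Leaf l: output guess l. *)
Inductive protocol : Type :=
| Leaf (l : nat)
| Node (k : nat) (K : nat) (M : nat -> Mat) (next : nat -> protocol).

Fixpoint valid (m : nat) (d : nat -> nat) (N : nat) (p : protocol) : Prop :=
  match p with
  | Leaf l => (l < N)%nat
  | Node k K M next =>
      (k < m)%nat /\
      mat_eq (d k) (Msum K (fun a => mmul (d k) (adj (M a)) (M a))) idm /\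
      forall a, (a < K)%nat -> valid m d N (next a)
  end.

Fixpoint effect (m : nat) (d : nat -> nat) (p : protocol) (i : nat) : Mat :=
  match p with
  | Leaf l => if Nat.eqb l i then idm else zerom
  | Node k K M next =>
      Msum K (fun a => mmul (dimH m d) (adj (lift m d k (M a)))
                        (mmul (dimH m d) (effect m d (next a) i) (lift m d k (M a))))
  end.

Definition LOCC_distinguishable (m : nat) (d : nat -> nat) (N : nat) (s : nat -> Mat) : Prop :=
  exists p : protocol, valid m d N p /\
    forall i j, (i < N)%nat -> (j < N)%nat ->
      trace (dimH m d) (mmul (dimH m d) (effect m d p i) (s j)) =
      if Nat.eqb i j then C1 else C0.

Definition avg (N : nat) (f : nat -> R) : R := Rsum N f / INR N.

Definition bounds (m : nat) (d : nat -> nat) (N : nat) (r e g : nat -> R) : Prop :=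
  let D := INR (dimH m d) in
  INR N <= D / avg N (fun i => 1 + r i) /\
  D / avg N (fun i => 1 + r i) <= D / avg N (fun i => Rpower 2 (e i)) /\
  D / avg N (fun i => Rpower 2 (e i)) <= D / avg N (fun i => Rpower 2 (g i)).

(* Main.v *)
From mathcomp Require all_boot all_order ssralg ssrnum matrix sesquilinear spectral complex Rstruct.
From Stdlib Require Import Reals Lra Lia Arith.
Require Import Defs.
Open Scope R_scope.

(** Let Pi_i be the effect of the LOCC protocol with outcome i.  The Pi_i are
    sums of product positive operators, they add up to the identity, and
    Tr(Pi_i sigma_i) = 1 forces Pi_i to fix the support of sigma_i.  Hence
    Pi_i >= |psi_i><psi_i|, and the separable state Pi_i / Tr Pi_i is a mixture
    of |psi_i><psi_i| with a density matrix, so 1 + R(psi_i) <= Tr Pi_i; summing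
    over i gives the first bound.  If omega = (psi psi* + R rho) / (1 + R) is
    separable, then <psi|omega^-1|psi> <= 1 + R, and Jensen's inequality for ln
    gives E_R <= log2 (1 + R).  Jensen's inequality also gives
    E_R >= - log2 <psi|omega|psi> for the optimal separable omega, and
    <psi|omega|psi> is an average of overlaps of psi with product vectors. *)

(** * Spectral theorem *)

(** Both operator facts about [Pi_i] are Cauchy-Schwarz for a positive form. Applied to
    [Q = I - Pi_i], it shows that a vector with zero expectation in [Q] is annihilated by [Q], which
    turns Tr(Q sigma_i) = 0 into a statement on the support. Applied to [Pi_i], with Pi_i psi = psi
    and |psi| = 1, it gives |<v|psi>|^2 = |<v|Pi_i psi>|^2 <= <v|Pi_i v>, which is Pi_i >=
    |psi><psi|. Locality enters at one point: a Kraus operator of one party is a product operator on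
    the whole space, so conjugation by it sends products of positive operators to such products. Two
    features of the definitions shape the rest. [rel_entropy] is a relation that admits any
    eigendecomposition of either state, and the eigenbasis of |psi><psi| is not unique; so its value
    is first rewritten through the overlaps of psi with the eigenvectors of omega, where Jensen
    applies. Matrices are functions on all of [nat] and agree only below the dimension, so operator
    identities are stated by testing on vectors. *)

(* [R] is a real closed field, hence [R[i]] is a [numClosedFieldType]:
   MathComp's spectral theorem is transported along [emb]. *)
Module Spectral.
Import all_boot all_order ssralg ssrnum matrix sesquilinear spectral complex Rstruct.
Import Order.TTheory GRing.Theory Num.Theory.
Local Open Scope ring_scope.

Notation C := Defs.C.
Definition emb (z : C) : R[i] := Complex (Defs.Re z) (Defs.Im z).
Definition unemb (z : R[i]) : C := mkC (complex.Re z) (complex.Im z).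

Lemma embK z : unemb (emb z) = z.
Proof. by case: z. Qed.

Lemma unembK z : emb (unemb z) = z.
Proof. by case: z. Qed.

Lemma emb_inj : injective emb.
Proof. exact: can_inj embK. Qed.

Lemma embM a b : emb (Cmul a b) = emb a * emb b.
Proof. by case: a b => [a a'] [b b']. Qed.

Lemma embD a b : emb (Cadd a b) = emb a + emb b.
Proof. by case: a b => [a a'] [b b']. Qed.

Lemma emb_conj a : emb (Cconj a) = (emb a)^*.
Proof. by case: a. Qed.

Lemma emb_sum n f : emb (Csum n f) = \sum_(k < n) emb (f k).
Proof.
elim: n => [|n IHn]; first by rewrite big_ord0.
by rewrite big_ord_recr /= embD IHn.
Qed.

(** A Hermitian matrix is normal, so B = P^* diag(D) P with P unitary; hermiticity also makes D
    real, so passing to real parts loses nothing. *)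
Lemma exists_eigendecomp n A :
  Defs.hermitian n A -> exists mu u, eigendecomp n A mu u.
Proof.
(* [inord] takes values in a nonempty ordinal type, so dimension zero is settled apart. *)
case: n => [|n] hA.
  by exists (fun _ => 0%R), (fun _ _ => C0); split => [k l /ssrnat.ltP|i j /ssrnat.ltP].
pose B : 'M[R[i]]_n.+1 := \matrix_(i, j) emb (A i j).
have hB : B \is hermsymmx.
  apply/is_hermitianmxP; rewrite expr0 scale1r; apply/matrixP => i j.
  by rewrite !mxE hA ?emb_conj //; apply/ssrnat.ltP.
have /orthomx_spectralP eB : B \is normalmx by exact: hermitian_normalmx.
have Preal := hermitian_spectral_diag_real hB.
have Pu := spectral_unitarymx B.
move: Preal Pu eB; set P := spectralmx B; set D := spectral_diag B => Dreal Pu eB.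
exists (fun k => complex.Re (D ord0 (inord k))).
(* The eigenvectors are the columns of P^*, that is, the conjugated rows of P. *)
exists (fun k i => unemb ((P (inord k) (inord i))^*)).
split.
- move=> k l /ssrnat.ltP hk /ssrnat.ltP hl; apply: emb_inj.
  have /unitarymxP /matrixP /(_ (inord k) (inord l)) := Pu.
  rewrite !mxE -(inj_eq val_inj) /= !inordK // => e.
  rewrite /inner emb_sum; transitivity ((k == l)%:R : R[i]).
    rewrite -e; apply: eq_bigr => i _.
    by rewrite !mxE embM emb_conj !unembK conjCK inord_val.
  have -> : (k == l) = Nat.eqb k l by apply/eqP/idP => /Nat.eqb_eq.
  by case: Nat.eqb.
- move=> i j /ssrnat.ltP hi /ssrnat.ltP hj; apply: emb_inj.
  move/matrixP: eB => /(_ (inord i) (inord j)).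
  rewrite invmx_unitary // !mxE !inordK // => ->.
  rewrite emb_sum; apply: eq_bigr => k _.
  rewrite !mxE (bigD1 k) //= big1 ?addr0; last first.
    by move=> l lk; rewrite !mxE (negbTE lk) mulr0n mulr0.
  rewrite /outer !embM emb_conj !unembK conjCK !mxE eqxx mulr1n inord_val.
  have -> : emb (RC (complex.Re (D ord0 k))) = D ord0 k.
    have /mxOverP /(_ ord0 k) := Dreal.
    case: (D ord0 k) => a b; rewrite realE !lecE /= => /orP[] /andP[/eqP e _].
      by rewrite /emb /= e.
    by rewrite /emb /= -e.
  by rewrite mulrCA mulrA.
Qed.

(** Orthonormality says U V = 1, where U has the conjugated vectors as rows and V the vectors as
    columns. A one-sided inverse of a square matrix is two-sided, and V U = 1 is completeness. *)
Lemma orthonormal_complete n (u : nat -> Vec) :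
  (forall k l, (k < n)%coq_nat -> (l < n)%coq_nat ->
     inner n (u k) (u l) = if Nat.eqb k l then C1 else C0) ->
  forall i j, (i < n)%coq_nat -> (j < n)%coq_nat ->
    Csum n (fun k => Cmul (u k i) (Cconj (u k j))) = if Nat.eqb i j then C1 else C0.
Proof.
have dE k l : emb (if Nat.eqb k l then C1 else C0) = (k == l)%:R.
  have -> : (k == l) = Nat.eqb k l by apply/eqP/idP => /Nat.eqb_eq.
  by case: Nat.eqb.
move=> uo; pose U : 'M[R[i]]_n := \matrix_(k, i) (emb (u k i))^*.
pose V : 'M[R[i]]_n := \matrix_(i, k) emb (u k i).
have /mulmx1C /matrixP VU : U *m V = 1%:M.
  apply/matrixP => k l; rewrite !mxE.
  have := congr1 emb (uo k l (ssrnat.ltP (ltn_ord k)) (ssrnat.ltP (ltn_ord l))).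
  rewrite dE emb_sum => <-; apply: eq_bigr => i _.
  by rewrite !mxE embM emb_conj.
move=> i j /ssrnat.ltP hi /ssrnat.ltP hj; apply: emb_inj.
have := VU (Ordinal hi) (Ordinal hj); rewrite dE !mxE => <-.
by rewrite emb_sum; apply: eq_bigr => k _; rewrite !mxE embM emb_conj.
Qed.
End Spectral.

(** * Complex numbers and finite sums *)

Definition Copp (a : Defs.C) : Defs.C := mkC (- Re a) (- Im a).
Definition Csub (a b : Defs.C) : Defs.C := Cadd a (Copp b).

Declare Scope C_scope.
Delimit Scope C_scope with C.
Infix "+" := Cadd : C_scope.
Infix "*" := Cmul : C_scope.
Infix "-" := Csub : C_scope.
Notation "- x" := (Copp x) : C_scope.
Bind Scope C_scope with Defs.C.

Lemma C_eq (a b : Defs.C) : Re a = Re b -> Im a = Im b -> a = b.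
Proof. destruct a, b; simpl; intros -> ->; reflexivity. Qed.

Lemma C_ring_theory : ring_theory C0 C1 Cadd Cmul Csub Copp eq.
Proof. constructor; intros; apply C_eq; simpl; ring. Qed.

Add Ring C_ring : C_ring_theory.

Lemma Cconj_add a b : Cconj (a + b)%C = (Cconj a + Cconj b)%C.
Proof. apply C_eq; simpl; ring. Qed.

Lemma Cconj_mul a b : Cconj (a * b)%C = (Cconj a * Cconj b)%C.
Proof. apply C_eq; simpl; ring. Qed.

Lemma Cconj_conj a : Cconj (Cconj a) = a.
Proof. apply C_eq; simpl; ring. Qed.

Lemma Cconj_RC x : Cconj (RC x) = RC x.
Proof. apply C_eq; simpl; ring. Qed.

Lemma RC_add x y : RC (x + y) = (RC x + RC y)%C.
Proof. apply C_eq; simpl; ring. Qed.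

Lemma RC_mul x y : RC (x * y) = (RC x * RC y)%C.
Proof. apply C_eq; simpl; ring. Qed.

Lemma Re_RC_mul x a : Re (RC x * a)%C = x * Re a.
Proof. simpl; ring. Qed.

Lemma Cmul_conj a : (a * Cconj a)%C = RC (Cnorm2 a).
Proof. unfold Cnorm2; apply C_eq; simpl; ring. Qed.

Lemma Cnorm2_nonneg a : 0 <= Cnorm2 a.
Proof. unfold Cnorm2; nra. Qed.

Lemma Cnorm2_conj a : Cnorm2 (Cconj a) = Cnorm2 a.
Proof. unfold Cnorm2; simpl; ring. Qed.

Lemma Cnorm2_mul a b : Cnorm2 (a * b)%C = Cnorm2 a * Cnorm2 b.
Proof. unfold Cnorm2; simpl; ring. Qed.

Lemma Cnorm2_eq0 a : Cnorm2 a = 0 -> a = C0.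
Proof. unfold Cnorm2; intro; apply C_eq; simpl; nra. Qed.

Lemma Cmul_eq0 a b : (a * b)%C = C0 -> a <> C0 -> b = C0.
Proof.
  intros e na.
  assert (e2 : Cnorm2 a * Cnorm2 b = 0) by (rewrite <- Cnorm2_mul, e; unfold Cnorm2; simpl; ring).
  apply Rmult_integral in e2; destruct e2 as [e2|e2]; apply Cnorm2_eq0 in e2; tauto.
Qed.

Lemma Rsum_ext n f g : (forall i, (i < n)%nat -> f i = g i) -> Rsum n f = Rsum n g.
Proof.
  induction n; intro h; simpl; [reflexivity|].
  rewrite IHn, h; auto with arith.
Qed.

Lemma Rsum_add n f g : Rsum n (fun i => f i + g i) = Rsum n f + Rsum n g.
Proof. induction n; simpl; [|rewrite IHn]; ring. Qed.

Lemma Rsum_mul_l n c f : Rsum n (fun i => c * f i) = c * Rsum n f.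
Proof. induction n; simpl; [|rewrite IHn]; ring. Qed.

Lemma Rsum_zero n : Rsum n (fun _ => 0) = 0.
Proof. induction n; simpl; [|rewrite IHn]; ring. Qed.

Lemma Rsum_swap n p f :
  Rsum n (fun i => Rsum p (fun j => f i j)) = Rsum p (fun j => Rsum n (fun i => f i j)).
Proof.
  induction n; simpl; [symmetry; apply Rsum_zero|].
  rewrite IHn, <- Rsum_add; reflexivity.
Qed.

Lemma Rsum_le n f g : (forall i, (i < n)%nat -> f i <= g i) -> Rsum n f <= Rsum n g.
Proof.
  induction n; intro h; simpl; [lra|].
  apply Rplus_le_compat; auto with arith.
Qed.

Lemma Rsum_nonneg n f : (forall i, (i < n)%nat -> 0 <= f i) -> 0 <= Rsum n f.
Proof. intro h; rewrite <- (Rsum_zero n); apply Rsum_le; exact h. Qed.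

Lemma Rsum_ge_term n f i :
  (forall j, (j < n)%nat -> 0 <= f j) -> (i < n)%nat -> f i <= Rsum n f.
Proof.
  induction n; intros h hi; [lia|]; simpl.
  destruct (Nat.eq_dec i n) as [->|ne].
  - assert (0 <= Rsum n f) by (apply Rsum_nonneg; auto with arith); lra.
  - assert (f i <= Rsum n f) by (apply IHn; [auto with arith|lia]).
    assert (0 <= f n) by auto with arith; lra.
Qed.

Lemma Rsum_eq0_term n f i :
  (forall j, (j < n)%nat -> 0 <= f j) -> Rsum n f = 0 -> (i < n)%nat -> f i = 0.
Proof.
  intros h e hi; assert (f i <= Rsum n f) by (apply Rsum_ge_term; assumption).
  specialize (h i hi); lra.
Qed.

Lemma Csum_ext n f g : (forall i, (i < n)%nat -> f i = g i) -> Csum n f = Csum n g.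
Proof.
  induction n; intro h; simpl; [reflexivity|].
  rewrite IHn, h; auto with arith.
Qed.

Lemma Csum_add n f g : Csum n (fun i => f i + g i)%C = (Csum n f + Csum n g)%C.
Proof. induction n; simpl; [|rewrite IHn]; ring. Qed.

Lemma Csum_mul_l n c f : Csum n (fun i => c * f i)%C = (c * Csum n f)%C.
Proof. induction n; simpl; [|rewrite IHn]; ring. Qed.

Lemma Csum_mul_r n c f : Csum n (fun i => f i * c)%C = (Csum n f * c)%C.
Proof. induction n; simpl; [|rewrite IHn]; ring. Qed.

Lemma Csum_zero n : Csum n (fun _ => C0) = C0.
Proof. induction n; simpl; [|rewrite IHn]; ring. Qed.

Lemma Csum_eq0 n f : (forall i, (i < n)%nat -> f i = C0) -> Csum n f = C0.
Proof. intro h; rewrite <- (Csum_zero n); apply Csum_ext; exact h. Qed.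

Lemma Csum_swap n p f :
  Csum n (fun i => Csum p (fun j => f i j)) = Csum p (fun j => Csum n (fun i => f i j)).
Proof.
  induction n; simpl; [symmetry; apply Csum_zero|].
  rewrite IHn, <- Csum_add; reflexivity.
Qed.

Lemma Csum_conj n f : Cconj (Csum n f) = Csum n (fun i => Cconj (f i)).
Proof.
  induction n; simpl; [apply C_eq; simpl; ring|].
  rewrite Cconj_add, IHn; reflexivity.
Qed.

Lemma Re_Csum n f : Re (Csum n f) = Rsum n (fun i => Re (f i)).
Proof. induction n; simpl; [|rewrite IHn]; reflexivity. Qed.

Lemma Csum_RC n f : Csum n (fun i => RC (f i)) = RC (Rsum n f).
Proof. induction n; simpl; [|rewrite IHn, RC_add]; reflexivity. Qed.

Lemma Csum_single n f j :
  (j < n)%nat -> (forall i, (i < n)%nat -> i <> j -> f i = C0) -> Csum n f = f j.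
Proof.
  induction n; intros hj h; [lia|]; simpl.
  destruct (Nat.eq_dec j n) as [->|ne].
  - rewrite Csum_eq0; [ring|]; intros; apply h; lia.
  - rewrite IHn, (h n); [ring|..]; auto with arith; lia.
Qed.

Lemma Csum_split a b f : Csum (a + b) f = (Csum a f + Csum b (fun i => f (a + i)%nat))%C.
Proof.
  induction b; simpl; [rewrite Nat.add_0_r; ring|].
  rewrite Nat.add_succ_r; simpl; rewrite IHb; ring.
Qed.

Lemma Csum_mul_index a b f :
  Csum (a * b) f = Csum b (fun q => Csum a (fun r => f (a * q + r)%nat)).
Proof.
  induction b; simpl; [rewrite Nat.mul_0_r; reflexivity|].
  rewrite Nat.mul_succ_r, Csum_split, IHb; reflexivity.
Qed.

Lemma Cprod_ext n f g : (forall i, (i < n)%nat -> f i = g i) -> Cprod n f = Cprod n g.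
Proof.
  induction n; intro h; simpl; [reflexivity|].
  rewrite IHn, h; auto with arith.
Qed.

Lemma Cprod_mul n f g : Cprod n (fun i => f i * g i)%C = (Cprod n f * Cprod n g)%C.
Proof. induction n; simpl; [|rewrite IHn]; ring. Qed.

Lemma Cprod_one n : Cprod n (fun _ => C1) = C1.
Proof. induction n; simpl; [|rewrite IHn]; ring. Qed.

Lemma Cprod_conj n f : Cconj (Cprod n f) = Cprod n (fun i => Cconj (f i)).
Proof.
  induction n; simpl; [apply C_eq; simpl; ring|].
  rewrite Cconj_mul, IHn; reflexivity.
Qed.

Lemma Cprod_eq0 n f i : (i < n)%nat -> f i = C0 -> Cprod n f = C0.
Proof.
  induction n; intros hi e; [lia|]; simpl.
  destruct (Nat.eq_dec i n) as [->|ne].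
  - rewrite e; ring.
  - rewrite IHn; [ring|lia|exact e].
Qed.

(** Isolates one factor of a product; linearity of tensor products in each party rests on it. *)
Lemma Cprod_slot n k x f :
  (k < n)%nat ->
  Cprod n (fun i => if Nat.eqb i k then x i else f i) =
  (x k * Cprod n (fun i => if Nat.eqb i k then C1 else f i))%C.
Proof.
  induction n; intro hk; [lia|]; simpl.
  destruct (Nat.eqb_spec n k) as [->|ne].
  - rewrite (Cprod_ext k _ (fun i => if Nat.eqb i k then C1 else f i)); [ring|].
    intros i hi; destruct (Nat.eqb_spec i k); [lia|reflexivity].
  - rewrite IHn; [ring|lia].
Qed.

Lemma Cprod_nonneg n f :
  (forall i, (i < n)%nat -> exists x, 0 <= x /\ f i = RC x) ->
  exists x, 0 <= x /\ Cprod n f = RC x.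
Proof.
  induction n; intro h; simpl; [exists 1; split; [lra|reflexivity]|].
  destruct IHn as [x [hx ->]]; [auto with arith|].
  destruct (h n) as [y [hy ->]]; [lia|].
  exists (x * y); split; [apply Rmult_le_pos; assumption|symmetry; apply RC_mul].
Qed.

(** * Sesquilinear forms and positive semidefinite matrices *)

(** The sesquilinear form <u|A v>. The positivity clause of [psd] is convertible to a statement
    about it, hence the [change] and [fold] steps below. *)
Definition form n A u v := inner n u (apply n A v).

Definition basisv (i : nat) : Vec := fun j => if Nat.eqb j i then C1 else C0.

Lemma form_expand n A u v :
  form n A u v = Csum n (fun i => Csum n (fun j => (Cconj (u i) * A i j * v j)%C)).
Proof.
  apply Csum_ext; intros i _; unfold apply.
  rewrite <- Csum_mul_l; apply Csum_ext; intros; ring.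
Qed.

Lemma inner_conj n u v : Cconj (inner n u v) = inner n v u.
Proof.
  unfold inner; rewrite Csum_conj; apply Csum_ext; intros.
  rewrite Cconj_mul, Cconj_conj; ring.
Qed.

Lemma inner_ext n u u' v v' :
  (forall i, (i < n)%nat -> u i = u' i) -> (forall i, (i < n)%nat -> v i = v' i) ->
  inner n u v = inner n u' v'.
Proof. intros hu hv; apply Csum_ext; intros; rewrite hu, hv; auto. Qed.

Lemma inner_sum_r n K u c v :
  inner n u (fun i => Csum K (fun k => (c k * v k i)%C)) =
  Csum K (fun k => (c k * inner n u (v k))%C).
Proof.
  unfold inner.
  transitivity (Csum n (fun i => Csum K (fun k => (c k * (Cconj (u i) * v k i))%C))).
  - apply Csum_ext; intros; rewrite <- Csum_mul_l; apply Csum_ext; intros; ring.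
  - rewrite Csum_swap; apply Csum_ext; intros; apply Csum_mul_l.
Qed.

Lemma inner_add_r n u v w c :
  inner n u (fun i => v i + c * w i)%C = (inner n u v + c * inner n u w)%C.
Proof.
  unfold inner; rewrite <- Csum_mul_l, <- Csum_add; apply Csum_ext; intros; ring.
Qed.

Lemma inner_add_l n u v w c :
  inner n (fun i => v i + c * w i)%C u = (inner n v u + Cconj c * inner n w u)%C.
Proof.
  rewrite <- inner_conj, inner_add_r, Cconj_add, Cconj_mul, !inner_conj; reflexivity.
Qed.

Lemma Re_inner_self_nonneg n u : 0 <= Re (inner n u u).
Proof.
  unfold inner; rewrite Re_Csum; apply Rsum_nonneg; intros; simpl; nra.
Qed.

Lemma form_ext n A B u v : mat_eq n A B -> form n A u v = form n B u v.
Proof.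
  intro h; rewrite !form_expand; apply Csum_ext; intros; apply Csum_ext; intros.
  rewrite h; auto.
Qed.

Lemma form_ext_r n A u v w :
  (forall i, (i < n)%nat -> v i = w i) -> form n A u v = form n A u w.
Proof.
  intro h; rewrite !form_expand; apply Csum_ext; intros; apply Csum_ext; intros.
  rewrite h; auto.
Qed.

Lemma form_add n A B u v :
  form n (fun i j => A i j + B i j)%C u v = (form n A u v + form n B u v)%C.
Proof.
  rewrite !form_expand, <- Csum_add; apply Csum_ext; intros.
  rewrite <- Csum_add; apply Csum_ext; intros; ring.
Qed.

Lemma form_scale n c A u v :
  form n (fun i j => c * A i j)%C u v = (c * form n A u v)%C.
Proof.
  rewrite !form_expand, <- Csum_mul_l; apply Csum_ext; intros.
  rewrite <- Csum_mul_l; apply Csum_ext; intros; ring.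
Qed.

Lemma form_zero n u v : form n zerom u v = C0.
Proof.
  rewrite form_expand; apply Csum_eq0; intros; apply Csum_eq0; intros; unfold zerom; ring.
Qed.

Lemma form_Msum n K A u v :
  form n (Msum K A) u v = Csum K (fun k => form n (A k) u v).
Proof.
  induction K; [apply form_zero|]; simpl; rewrite <- IHK, <- form_add; reflexivity.
Qed.

Lemma form_idm n u v : form n idm u v = inner n u v.
Proof.
  rewrite form_expand; apply Csum_ext; intros i hi.
  rewrite (Csum_single _ _ i); [unfold idm; rewrite Nat.eqb_refl; ring|exact hi|].
  intros j hj ne; unfold idm; destruct (Nat.eqb_spec i j); [congruence|ring].
Qed.

Lemma form_outer n w u v : form n (outer w w) u v = (inner n u w * inner n w v)%C.
Proof.
  rewrite form_expand; unfold inner at 1; rewrite <- Csum_mul_r; apply Csum_ext; intros.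
  unfold inner; rewrite <- Csum_mul_l; apply Csum_ext; intros; unfold outer; ring.
Qed.

Lemma form_sum_r n A K u c v :
  form n A u (fun i => Csum K (fun k => (c k * v k i)%C)) =
  Csum K (fun k => (c k * form n A u (v k))%C).
Proof.
  unfold form; rewrite <- inner_sum_r; apply inner_ext; [reflexivity|]; intros i _.
  unfold apply.
  transitivity (Csum n (fun j => Csum K (fun k => (c k * (A i j * v k j))%C))).
  - apply Csum_ext; intros; rewrite <- Csum_mul_l; apply Csum_ext; intros; ring.
  - rewrite Csum_swap; apply Csum_ext; intros; apply Csum_mul_l.
Qed.

Lemma form_add_r n A u v w c :
  form n A u (fun i => v i + c * w i)%C = (form n A u v + c * form n A u w)%C.
Proof.
  unfold form; rewrite <- inner_add_r; apply inner_ext; [reflexivity|]; intros i _.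
  unfold apply; rewrite <- Csum_mul_l, <- Csum_add; apply Csum_ext; intros; ring.
Qed.

Lemma form_add_l n A u v w c :
  form n A (fun i => v i + c * w i)%C u = (form n A v u + Cconj c * form n A w u)%C.
Proof. apply inner_add_l. Qed.

Lemma basisv_sum n f i : (i < n)%nat -> Csum n (fun k => (basisv i k * f k)%C) = f i.
Proof.
  intro hi; rewrite (Csum_single _ _ i); [unfold basisv; rewrite Nat.eqb_refl; ring|exact hi|].
  intros j _ ne; unfold basisv; destruct (Nat.eqb_spec j i); [congruence|ring].
Qed.

Lemma Cconj_basisv i k : Cconj (basisv i k) = basisv i k.
Proof. unfold basisv; destruct Nat.eqb; apply C_eq; simpl; ring. Qed.

Lemma inner_basisv n i v : (i < n)%nat -> inner n (basisv i) v = v i.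
Proof.
  intro hi; unfold inner; rewrite <- (basisv_sum n v i hi).
  apply Csum_ext; intros; rewrite Cconj_basisv; reflexivity.
Qed.

Lemma unitv_basisv n i : (i < n)%nat -> unitv n (basisv i).
Proof.
  intro hi; unfold unitv; rewrite inner_basisv by exact hi.
  unfold basisv; rewrite Nat.eqb_refl; reflexivity.
Qed.

Lemma form_basisv n A i j :
  (i < n)%nat -> (j < n)%nat -> form n A (basisv i) (basisv j) = A i j.
Proof.
  intros hi hj; unfold form; rewrite inner_basisv by exact hi; unfold apply.
  rewrite <- (basisv_sum n (A i) j hj); apply Csum_ext; intros; ring.
Qed.

Lemma form_conj n A u v : hermitian n A -> Cconj (form n A u v) = form n A v u.
Proof.
  intro h; rewrite !form_expand, Csum_conj.
  transitivity (Csum n (fun i => Csum n (fun j => Cconj (Cconj (u i) * A i j * v j)%C))).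
  { apply Csum_ext; intros; apply Csum_conj. }
  rewrite Csum_swap; apply Csum_ext; intros i hi; apply Csum_ext; intros j hj.
  rewrite !Cconj_mul, Cconj_conj, (h i j hi hj); ring.
Qed.

Lemma form_self_real n A u :
  hermitian n A -> form n A u u = RC (Re (form n A u u)).
Proof.
  intro h; pose proof (form_conj n A u u h) as e.
  apply (f_equal Im) in e; simpl in e; apply C_eq; simpl; lra.
Qed.

Lemma psd_outer n w : psd n (outer w w).
Proof.
  split.
  - intros i j _ _; unfold outer; rewrite Cconj_mul, Cconj_conj; ring.
  - intro v; change (0 <= Re (form n (outer w w) v v)).
    rewrite form_outer, <- (inner_conj n w v).
    replace (Cconj (inner n w v) * inner n w v)%C with (RC (Cnorm2 (inner n w v)))
      by (rewrite <- Cmul_conj; ring).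
    apply Cnorm2_nonneg.
Qed.

Lemma psd_zero n : psd n zerom.
Proof.
  split.
  - intros i j _ _; apply C_eq; simpl; ring.
  - intro v; change (0 <= Re (form n zerom v v)); rewrite form_zero; simpl; lra.
Qed.

Lemma psd_idm n : psd n idm.
Proof.
  split.
  - intros i j _ _; unfold idm; rewrite Nat.eqb_sym; destruct Nat.eqb; apply C_eq; simpl; ring.
  - intro v; change (0 <= Re (form n idm v v)); rewrite form_idm; apply Re_inner_self_nonneg.
Qed.

Lemma psd_add n A B : psd n A -> psd n B -> psd n (fun i j => A i j + B i j)%C.
Proof.
  intros [hA pA] [hB pB]; split.
  - intros i j hi hj; rewrite Cconj_add, <- hA, <- hB by assumption; reflexivity.
  - intro v; change (0 <= Re (form n (fun i j => A i j + B i j)%C v v)).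
    rewrite form_add; specialize (pA v); specialize (pB v); fold (form n A v v) in pA.
    fold (form n B v v) in pB; simpl; lra.
Qed.

Lemma psd_scale n x A : 0 <= x -> psd n A -> psd n (fun i j => RC x * A i j)%C.
Proof.
  intros hx [hA pA]; split.
  - intros i j hi hj; rewrite Cconj_mul, Cconj_RC, <- hA by assumption; reflexivity.
  - intro v; change (0 <= Re (form n (fun i j => RC x * A i j)%C v v)).
    rewrite form_scale, Re_RC_mul; apply Rmult_le_pos; [exact hx|apply pA].
Qed.

Lemma psd_Msum n K A : (forall k, (k < K)%nat -> psd n (A k)) -> psd n (Msum K A).
Proof.
  induction K; intro h; [apply psd_zero|].
  apply (psd_add n (Msum K A) (A K)); auto with arith.
Qed.

(** Positivity on u - t conj(f) v, with f = <u|A v>, gives for every real t the inequality a - 2 t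
    |f|^2 + t^2 |f|^2 b >= 0, where a and b are the expectations of u and v; t = 1/b concludes when
    b is nonzero. *)
Lemma psd_cauchy_schwarz n A u v :
  psd n A -> Cnorm2 (form n A u v) <= Re (form n A u u) * Re (form n A v v).
Proof.
  intros [h p]; set (f := form n A u v).
  assert (q : forall t, 0 <= Re (form n A u u) - 2 * t * Cnorm2 f
                             + t * t * Cnorm2 f * Re (form n A v v)).
  { intro t; pose proof (p (fun i => u i + (RC (- t) * Cconj f) * v i)%C) as q.
    fold (form n A (fun i => u i + (RC (- t) * Cconj f) * v i)%C
                   (fun i => u i + (RC (- t) * Cconj f) * v i)%C) in q.
    rewrite form_add_l, !form_add_r in q.
    rewrite <- (form_conj n A u v h), (form_self_real n A v h) in q.
    fold f in q; unfold Cnorm2; simpl in q; nra. }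
  pose proof (p v) as pv; fold (form n A v v) in pv.
  pose proof (Cnorm2_nonneg f) as pf.
  set (a := Re (form n A u u)) in *; set (b := Re (form n A v v)) in *.
  set (z := Cnorm2 f) in *; clearbody a b z; clear - q pv pf.
  destruct (Req_dec b 0) as [->|nb].
  - destruct (Req_dec z 0) as [->|nz]; [lra|].
    (* With b = 0 the inequality is affine in t, and this t makes its left side equal to -1. *)
    specialize (q ((a + 1) / (2 * z))).
    replace (2 * ((a + 1) / (2 * z)) * z) with (a + 1) in q by (field; lra); lra.
  - specialize (q (/ b)).
    assert (e : 0 <= b * (a - 2 * / b * z + / b * / b * z * b)) by (apply Rmult_le_pos; lra).
    replace (b * (a - 2 * / b * z + / b * / b * z * b)) with (a * b - z) in e by (field; lra).
    lra.
Qed.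

Lemma psd_form_eq0 n A u v : psd n A -> Re (form n A v v) = 0 -> form n A u v = C0.
Proof.
  intros h e; apply Cnorm2_eq0.
  pose proof (psd_cauchy_schwarz n A u v h); pose proof (Cnorm2_nonneg (form n A u v)).
  rewrite e in *; lra.
Qed.

Lemma psd_diag_nonneg n A i : psd n A -> (i < n)%nat -> 0 <= Re (A i i).
Proof. intros h hi; rewrite <- (form_basisv n A i i hi hi); apply h. Qed.

Lemma psd_trace_nonneg n A : psd n A -> 0 <= Re (trace n A).
Proof.
  intro h; unfold trace; rewrite Re_Csum; apply Rsum_nonneg; intros.
  apply (psd_diag_nonneg n); assumption.
Qed.

Lemma psd_trace_real n A : psd n A -> trace n A = RC (Re (trace n A)).
Proof.
  intros [h _]; apply C_eq; [reflexivity|]; simpl.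
  enough (e : Cconj (trace n A) = trace n A) by (apply (f_equal Im) in e; simpl in e; lra).
  unfold trace; rewrite Csum_conj; apply Csum_ext; intros; symmetry; auto.
Qed.

(** The diagonal entries are nonnegative with sum zero, so each basis vector has expectation zero
    and is annihilated. *)
Lemma psd_trace_eq0 n A : psd n A -> Re (trace n A) = 0 -> mat_eq n A zerom.
Proof.
  intros h e i j hi hj; unfold trace in e; rewrite Re_Csum in e.
  rewrite <- (form_basisv n A i j hi hj); apply psd_form_eq0; [exact h|].
  rewrite form_basisv by assumption.
  apply (Rsum_eq0_term n (fun k => Re (A k k))); try assumption.
  intros; apply (psd_diag_nonneg n); assumption.
Qed.

Lemma trace_ext n A B : mat_eq n A B -> trace n A = trace n B.
Proof. intro h; apply Csum_ext; auto. Qed.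

Lemma trace_add n A B :
  trace n (fun i j => A i j + B i j)%C = (trace n A + trace n B)%C.
Proof. apply Csum_add. Qed.

Lemma trace_scale n c A : trace n (fun i j => c * A i j)%C = (c * trace n A)%C.
Proof. apply Csum_mul_l. Qed.

Lemma trace_outer n u : trace n (outer u u) = inner n u u.
Proof. apply Csum_ext; intros; unfold outer; ring. Qed.

Lemma trace_Msum n K A : trace n (Msum K A) = Csum K (fun k => trace n (A k)).
Proof. apply Csum_swap. Qed.

Lemma trace_idm n : trace n idm = RC (INR n).
Proof.
  transitivity (Csum n (fun _ => RC 1)).
  - apply Csum_ext; intros; unfold idm; rewrite Nat.eqb_refl; reflexivity.
  - rewrite Csum_RC; f_equal; induction n; [reflexivity|].
    rewrite S_INR; simpl Rsum; rewrite IHn; reflexivity.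
Qed.

Lemma density_outer n u : unitv n u -> density n (outer u u).
Proof. intro h; split; [apply psd_outer|rewrite trace_outer; exact h]. Qed.

Lemma mmul_ext n A A' B B' :
  mat_eq n A A' -> mat_eq n B B' -> mat_eq n (mmul n A B) (mmul n A' B').
Proof.
  intros hA hB i j hi hj; apply Csum_ext; intros; rewrite hA, hB; auto.
Qed.

Lemma mmul_idm_l n A i j : (i < n)%nat -> mmul n idm A i j = A i j.
Proof.
  intro hi; unfold mmul; rewrite (Csum_single _ _ i); [|exact hi|].
  - unfold idm; rewrite Nat.eqb_refl; ring.
  - intros k _ ne; unfold idm; destruct (Nat.eqb_spec i k); [congruence|ring].
Qed.

Lemma mmul_idm_r n A i j : (j < n)%nat -> mmul n A idm i j = A i j.
Proof.
  intro hj; unfold mmul; rewrite (Csum_single _ _ j); [|exact hj|].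
  - unfold idm; rewrite Nat.eqb_refl; ring.
  - intros k _ ne; unfold idm; destruct (Nat.eqb_spec k j); [congruence|ring].
Qed.

Lemma mmul_Msum_l n K A B i j :
  mmul n (Msum K A) B i j = Csum K (fun k => mmul n (A k) B i j).
Proof.
  unfold mmul, Msum; rewrite Csum_swap; apply Csum_ext; intros.
  symmetry; apply Csum_mul_r.
Qed.

Lemma mmul_Msum_r n K A B i j :
  mmul n B (Msum K A) i j = Csum K (fun k => mmul n B (A k) i j).
Proof.
  unfold mmul, Msum; rewrite Csum_swap; apply Csum_ext; intros.
  symmetry; apply Csum_mul_l.
Qed.

Lemma apply_mmul n A B v i : apply n (mmul n A B) v i = apply n A (apply n B v) i.
Proof.
  unfold apply, mmul.
  transitivity (Csum n (fun j => Csum n (fun k => (A i k * B k j * v j)%C))).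
  - apply Csum_ext; intros; symmetry; apply Csum_mul_r.
  - rewrite Csum_swap; apply Csum_ext; intros; rewrite <- Csum_mul_l.
    apply Csum_ext; intros; ring.
Qed.

Lemma inner_adj n A u v : inner n u (apply n (adj A) v) = inner n (apply n A u) v.
Proof.
  rewrite <- (inner_conj n v).
  change (inner n u (apply n (adj A) v)) with (form n (adj A) u v).
  change (inner n v (apply n A u)) with (form n A v u).
  rewrite !form_expand, Csum_conj, Csum_swap; apply Csum_ext; intros.
  rewrite Csum_conj; apply Csum_ext; intros.
  unfold adj; rewrite !Cconj_mul, Cconj_conj; ring.
Qed.

(** The Kraus conjugation M^* A M, convertible to the summand in the [Node] case of [effect]. *)
Definition sandwich n M A := mmul n (adj M) (mmul n A M).

Lemma psd_sandwich n M A : psd n A -> psd n (sandwich n M A).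
Proof.
  intros [h p]; split.
  - intros i j hi hj; unfold sandwich, mmul, adj.
    rewrite Csum_conj.
    transitivity (Csum n (fun k => Csum n (fun l => (Cconj (M k i) * A k l * M l j)%C))).
    { apply Csum_ext; intros; rewrite <- Csum_mul_l; apply Csum_ext; intros; ring. }
    rewrite Csum_swap; apply Csum_ext; intros k hk.
    rewrite Cconj_mul, Cconj_conj, Csum_conj, <- Csum_mul_l; apply Csum_ext; intros l hl.
    rewrite Cconj_mul, <- (h l k hl hk); ring.
  - intro v.
    replace (inner n v (apply n (sandwich n M A) v)) with (form n A (apply n M v) (apply n M v)).
    { apply p. }
    unfold form; rewrite <- inner_adj; apply inner_ext; [reflexivity|]; intros i _.
    unfold sandwich; rewrite apply_mmul; unfold apply at 1 3; apply Csum_ext; intros.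
    rewrite apply_mmul; reflexivity.
Qed.

Lemma mmul_outer_trace n A u : trace n (mmul n A (outer u u)) = form n A u u.
Proof.
  rewrite form_expand; apply Csum_ext; intros; apply Csum_ext; intros; unfold outer; ring.
Qed.

(** * Product matrices and the effects of LOCC protocols *)

(** Replaces the factor of party [k]. With [fun _ => idm] for [rho], its [prodmat] is convertible to
    [lift m d k A]. *)
Definition slot (k : nat) (A : Mat) (rho : nat -> Mat) : nat -> Mat :=
  fun l => if Nat.eqb l k then A else rho l.

(** * Mixed-radix indices and tensor products *)

Lemma prodd_factor d k m : (k < m)%nat -> exists c, prodd d m = (prodd d k * d k * c)%nat.
Proof.
  induction m; intro hk; [lia|].
  destruct (Nat.eq_dec k m) as [->|ne].
  - exists 1%nat; unfold prodd; simpl; lia.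
  - destruct IHm as [c e]; [lia|]; exists (c * d m)%nat.
    unfold prodd in *; simpl; rewrite e; ring.
Qed.

Lemma prodd_pos d m : (forall k, (k < m)%nat -> (1 <= d k)%nat) -> (1 <= prodd d m)%nat.
Proof.
  induction m; intro h; [unfold prodd; simpl; lia|].
  assert (1 <= prodd d m)%nat by auto with arith; assert (1 <= d m)%nat by auto with arith.
  unfold prodd in *; simpl; nia.
Qed.

Lemma digit_lt d i k : (1 <= d k)%nat -> (digit d i k < d k)%nat.
Proof. intro; apply Nat.mod_upper_bound; lia. Qed.

(** [prodd d m] is a multiple of [prodd d k * d k], so the added term changes the quotient by
    [prodd d k] only by a multiple of [d k]. *)
Lemma digit_low d m q r k :
  (r < prodd d m)%nat -> (k < m)%nat -> digit d (prodd d m * q + r) k = digit d r k.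
Proof.
  intros hr hk; destruct (prodd_factor d k m hk) as [c e]; unfold digit.
  replace (prodd d m * q + r)%nat with (r + c * q * d k * prodd d k)%nat by (rewrite e; ring).
  rewrite Nat.div_add by nia.
  apply Nat.Div0.mod_add.
Qed.

Lemma digit_high d m q r :
  (r < prodd d m)%nat -> (q < d m)%nat -> digit d (prodd d m * q + r) m = q.
Proof.
  intros hr hq; unfold digit.
  replace (prodd d m * q + r)%nat with (r + q * prodd d m)%nat by ring.
  rewrite Nat.div_add, Nat.div_small, Nat.mod_small by lia; reflexivity.
Qed.

Lemma digit_inj d m i j :
  (i < prodd d m)%nat -> (j < prodd d m)%nat ->
  (forall k, (k < m)%nat -> digit d i k = digit d j k) -> i = j.
Proof.
  intros hi hj h.
  (* The bounds do not pass to smaller [m]. Replacing both indices by their residues gives a claim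
     that does, through i mod (P d) = i mod P + P ((i / P) mod d). *)
  rewrite <- (Nat.mod_small i (prodd d m)), <- (Nat.mod_small j (prodd d m)) by assumption.
  clear hi hj; induction m; [unfold prodd; simpl; reflexivity|].
  change (prodd d (S m)) with (prodd d m * d m)%nat.
  rewrite !Nat.Div0.mod_mul_r, IHm by auto with arith.
  fold (digit d i m); fold (digit d j m); rewrite h by lia; reflexivity.
Qed.

(** Distributivity: a global index is the tuple of its digits, so the sum runs over all choices of
    one term per factor. Products and traces of tensor products factor because of it. *)
Lemma Csum_prodd m d F :
  Csum (prodd d m) (fun i => Cprod m (fun k => F k (digit d i k))) =
  Cprod m (fun k => Csum (d k) (F k)).
Proof.
  induction m; [unfold prodd; simpl; ring|]; simpl Cprod.
  change (prodd d (S m)) with (prodd d m * d m)%nat; rewrite Csum_mul_index, <- IHm.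
  rewrite <- Csum_mul_l; apply Csum_ext; intros q hq.
  rewrite <- Csum_mul_r; apply Csum_ext; intros r hr.
  rewrite digit_high by assumption; f_equal; apply Cprod_ext; intros k hk.
  rewrite digit_low by assumption; reflexivity.
Qed.

Lemma prodmat_ext m d A B :
  (forall k, (k < m)%nat -> (1 <= d k)%nat) ->
  (forall k, (k < m)%nat -> mat_eq (d k) (A k) (B k)) ->
  forall i j, prodmat m d A i j = prodmat m d B i j.
Proof.
  intros hd h i j; apply Cprod_ext; intros k hk; apply (h k hk); apply digit_lt; auto.
Qed.

Lemma prodmat_idm m d : mat_eq (dimH m d) (prodmat m d (fun _ => idm)) idm.
Proof.
  intros i j hi hj; unfold prodmat, idm at 2.
  destruct (Nat.eqb_spec i j) as [->|ne].
  - rewrite <- (Cprod_one m); apply Cprod_ext; intros; unfold idm.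
    rewrite Nat.eqb_refl; reflexivity.
  - assert (hk : exists k, (k < m)%nat /\ digit d i k <> digit d j k).
    (* A bounded search finds a digit in which the indices differ; full agreement would contradict
       [digit_inj]. The identity factor of that party then vanishes. *)
    { enough (D : forall n, (forall k, (k < n)%nat -> digit d i k = digit d j k) \/
                      exists k, (k < n)%nat /\ digit d i k <> digit d j k).
      { destruct (D m) as [e|e]; [|exact e].
        exfalso; apply ne, (digit_inj d m); assumption. }
      induction n as [|n [IH|[k [hk IH]]]]; [left; lia| |right; exists k; split; [lia|exact IH]].
      destruct (Nat.eq_dec (digit d i n) (digit d j n)) as [e|e].
      - left; intros k hk; destruct (Nat.eq_dec k n) as [->|]; [exact e|apply IH; lia].
      - right; exists n; split; [lia|exact e]. }
    destruct hk as [k [hk e]]; apply (Cprod_eq0 _ _ k hk); unfold idm.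
    destruct (Nat.eqb_spec (digit d i k) (digit d j k)); [contradiction|reflexivity].
Qed.

Lemma prodmat_mul m d A B i j :
  mmul (dimH m d) (prodmat m d A) (prodmat m d B) i j =
  prodmat m d (fun k => mmul (d k) (A k) (B k)) i j.
Proof.
  unfold prodmat at 3, mmul at 2.
  rewrite <- (Csum_prodd m d (fun k x => A k (digit d i k) x * B k x (digit d j k))%C).
  apply Csum_ext; intros; symmetry; apply Cprod_mul.
Qed.

Lemma prodmat_adj m d A i j :
  adj (prodmat m d A) i j = prodmat m d (fun k => adj (A k)) i j.
Proof. apply Cprod_conj. Qed.

Lemma prodmat_sandwich m d A B i j :
  sandwich (dimH m d) (prodmat m d A) (prodmat m d B) i j =
  prodmat m d (fun k => sandwich (d k) (A k) (B k)) i j.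
Proof.
  unfold sandwich at 2; rewrite <- prodmat_mul; unfold sandwich.
  apply Csum_ext; intros; rewrite prodmat_adj, prodmat_mul; reflexivity.
Qed.

Lemma prodmat_trace m d A :
  trace (dimH m d) (prodmat m d A) = Cprod m (fun k => trace (d k) (A k)).
Proof. apply (Csum_prodd m d (fun k x => A k x x)). Qed.

Lemma prodmat_outer m d phi i j :
  prodmat m d (fun k => outer (phi k) (phi k)) i j =
  outer (prodvec m d phi) (prodvec m d phi) i j.
Proof. unfold outer, prodvec; rewrite Cprod_conj, <- Cprod_mul; reflexivity. Qed.

Lemma prodmat_slot m d k A rho i j :
  (k < m)%nat ->
  prodmat m d (slot k A rho) i j =
  (A (digit d i k) (digit d j k) *
   Cprod m (fun l => if Nat.eqb l k then C1 else rho l (digit d i l) (digit d j l)))%C.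
Proof.
  intro hk; rewrite <- (Cprod_slot m k (fun l => A (digit d i l) (digit d j l))) by exact hk.
  apply Cprod_ext; intros l _; unfold slot; destruct Nat.eqb; reflexivity.
Qed.

Lemma prodmat_slot_sum m d k K c A rho i j :
  (k < m)%nat ->
  prodmat m d (slot k (fun x y => Csum K (fun a => c a * A a x y)%C) rho) i j =
  Csum K (fun a => c a * prodmat m d (slot k (A a) rho) i j)%C.
Proof.
  intro hk; rewrite prodmat_slot by exact hk; rewrite <- Csum_mul_r.
  apply Csum_ext; intros; rewrite prodmat_slot by exact hk; ring.
Qed.

(** The products M_a^* M_a occupy slot [k], the other slots hold the identity, and [prodmat] is
    linear in slot [k]; so the sum can be taken inside that slot. *)
Lemma lift_completeness m d k K M :
  (forall l, (l < m)%nat -> (1 <= d l)%nat) -> (k < m)%nat ->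
  mat_eq (d k) (Msum K (fun a => mmul (d k) (adj (M a)) (M a))) idm ->
  mat_eq (dimH m d)
    (Msum K (fun a => mmul (dimH m d) (adj (lift m d k (M a))) (lift m d k (M a)))) idm.
Proof.
  intros hd hk h i j hi hj.
  rewrite <- (prodmat_idm m d i j hi hj).
  rewrite <- (prodmat_ext m d (slot k (Msum K (fun a => mmul (d k) (adj (M a)) (M a)))
                                      (fun _ => idm))); [|exact hd|].
  - rewrite prodmat_slot by exact hk; unfold Msum; rewrite <- Csum_mul_r.
    apply Csum_ext; intros a _; rewrite <- prodmat_slot by exact hk.
    transitivity (prodmat m d (fun l => mmul (d l) (adj (slot k (M a) (fun _ => idm) l))
                                             (slot k (M a) (fun _ => idm) l)) i j).
    + rewrite <- prodmat_mul; apply Csum_ext; intros; f_equal.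
      rewrite <- prodmat_adj; reflexivity.
    + apply prodmat_ext; [exact hd|]; intros l hl x y hx hy; unfold slot.
      destruct (Nat.eqb_spec l k) as [->|]; [reflexivity|].
      rewrite mmul_idm_r by assumption; unfold adj, idm; rewrite Nat.eqb_sym.
      destruct Nat.eqb; apply C_eq; simpl; ring.
  - intros l hl x y hx hy; unfold slot; destruct (Nat.eqb_spec l k) as [->|]; auto.
Qed.

(** Unnormalised separable operators: weights are absorbed into the positive factors, so no trace
    has to be tracked while the protocol is unfolded. Both constructors work up to [mat_eq], as
    entries outside the dimension are arbitrary. *)
Inductive sep_cone (m : nat) (d : nat -> nat) : Mat -> Prop :=
| sep_cone_zero W : mat_eq (dimH m d) W zerom -> sep_cone m d W
| sep_cone_cons W V rho :
    sep_cone m d V -> (forall k, (k < m)%nat -> psd (d k) (rho k)) ->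
    mat_eq (dimH m d) W (fun i j => V i j + prodmat m d rho i j)%C -> sep_cone m d W.

Lemma sep_cone_ext m d V W : mat_eq (dimH m d) W V -> sep_cone m d V -> sep_cone m d W.
Proof.
  intros e h; destruct h as [V h|V U rho hU hrho h].
  - apply sep_cone_zero; intros i j hi hj; rewrite e; auto.
  - apply (sep_cone_cons _ _ _ U rho); try assumption.
    intros i j hi hj; rewrite e; auto.
Qed.

Lemma sep_cone_add m d V W :
  sep_cone m d V -> sep_cone m d W -> sep_cone m d (fun i j => V i j + W i j)%C.
Proof.
  intros hV hW; induction hW as [W h|W U rho hU IH hrho h].
  - apply (sep_cone_ext m d V); [|exact hV].
    intros i j hi hj; rewrite h by assumption; unfold zerom; ring.
  - apply (sep_cone_cons _ _ _ _ rho IH hrho).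
    intros i j hi hj; rewrite h by assumption; ring.
Qed.

Lemma sep_cone_Msum m d K W :
  (forall a, (a < K)%nat -> sep_cone m d (W a)) -> sep_cone m d (Msum K W).
Proof.
  induction K; intro h; [apply sep_cone_zero; intros i j _ _; reflexivity|].
  apply (sep_cone_add m d (Msum K W) (W K)); auto with arith.
Qed.

Lemma sep_cone_idm m d : sep_cone m d idm.
Proof.
  apply (sep_cone_cons m d idm zerom (fun _ => idm)).
  - apply sep_cone_zero; intros i j _ _; reflexivity.
  - intros; apply psd_idm.
  - intros i j hi hj; rewrite prodmat_idm by assumption; unfold zerom; ring.
Qed.

Lemma sandwich_ext n M A B : mat_eq n A B -> mat_eq n (sandwich n M A) (sandwich n M B).
Proof.
  intro h; apply mmul_ext; [intros i j _ _; reflexivity|].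
  apply mmul_ext; [exact h|intros i j _ _; reflexivity].
Qed.

Lemma sandwich_add n M A B i j :
  sandwich n M (fun i j => A i j + B i j)%C i j = (sandwich n M A i j + sandwich n M B i j)%C.
Proof.
  unfold sandwich, mmul; rewrite <- Csum_add; apply Csum_ext; intros.
  assert (e : forall c x y, (c * (x + y) = c * x + c * y)%C) by (intros; ring).
  rewrite <- e, <- Csum_add; f_equal; apply Csum_ext; intros; ring.
Qed.

Lemma sandwich_zero n M i j : sandwich n M zerom i j = C0.
Proof.
  unfold sandwich, mmul; apply Csum_eq0; intros; rewrite Csum_eq0; [ring|].
  intros; unfold zerom; ring.
Qed.

(** The lifted operator is itself a product, so the conjugation acts factor by factor and each
    factor stays positive. *)
Lemma sep_cone_sandwich m d k M W :
  sep_cone m d W -> sep_cone m d (sandwich (dimH m d) (lift m d k M) W).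
Proof.
  intro h; induction h as [W h|W V rho hV IH hrho h].
  - apply sep_cone_zero; intros i j hi hj.
    rewrite (sandwich_ext _ _ W zerom h i j hi hj); apply sandwich_zero.
  - apply (sep_cone_cons _ _ _ _
             (fun l => sandwich (d l) (if Nat.eqb l k then M else idm) (rho l)) IH).
    + intros l hl; apply psd_sandwich; auto.
    + intros i j hi hj; rewrite (sandwich_ext _ _ _ _ h i j hi hj), sandwich_add.
      f_equal; apply prodmat_sandwich.
Qed.

Lemma effect_sep_cone m d N p i : valid m d N p -> sep_cone m d (effect m d p i).
Proof.
  induction p as [l|k K M next IH]; simpl; intro h.
  - destruct Nat.eqb; [apply sep_cone_idm|apply sep_cone_zero; intros x y _ _; reflexivity].
  - destruct h as [_ [_ h]]; apply sep_cone_Msum; intros a ha.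
    apply sep_cone_sandwich; auto.
Qed.

Lemma effect_psd m d p i : psd (dimH m d) (effect m d p i).
Proof.
  induction p as [l|k K M next IH]; simpl.
  - destruct Nat.eqb; [apply psd_idm|apply psd_zero].
  - apply psd_Msum; intros a _; apply psd_sandwich, IH.
Qed.

(** At a node, summing over the final outcomes first turns each inner effect into the identity by
    induction; what remains is the sum of M_a^* M_a for the lifted operators. At a leaf exactly one
    outcome contributes. *)
Lemma effect_complete m d N p :
  (forall k, (k < m)%nat -> (1 <= d k)%nat) -> valid m d N p ->
  mat_eq (dimH m d) (Msum N (effect m d p)) idm.
Proof.
  intro hd; induction p as [l|k K M next IH]; intros h i j hi hj.
  - simpl in h; unfold Msum; simpl.
    rewrite (Csum_single _ _ l h); [rewrite Nat.eqb_refl; reflexivity|].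
    intros a _ ne; destruct (Nat.eqb_spec l a); [congruence|reflexivity].
  - destruct h as [hk [hM h]].
    rewrite <- (lift_completeness m d k K M hd hk hM i j hi hj).
    unfold Msum; simpl effect; unfold Msum; rewrite Csum_swap; apply Csum_ext; intros a ha.
    rewrite <- mmul_Msum_r.
    apply mmul_ext; [intros x y _ _; reflexivity| |exact hi|exact hj].
    intros x y hx hy; unfold Msum; rewrite <- mmul_Msum_l.
    rewrite (mmul_ext _ _ idm _ (lift m d k (M a)) (IH a (h a ha))); try assumption.
    + apply mmul_idm_l; exact hx.
    + intros u v _ _; reflexivity.
Qed.

(** * From the cone to normalised separable states *)

Lemma sep_cone_explicit m d W :
  sep_cone m d W -> exists K rho,
    (forall j k, (j < K)%nat -> (k < m)%nat -> psd (d k) (rho j k)) /\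
    mat_eq (dimH m d) W (Msum K (fun j => prodmat m d (rho j))).
Proof.
  induction 1 as [W h|W V rho hV [K [tau [htau e]]] hrho h].
  - exists 0%nat, (fun _ _ => zerom); split; [lia|exact h].
  - exists (S K), (fun j => if Nat.ltb j K then tau j else rho); split.
    + intros j k hj hk; destruct (Nat.ltb_spec j K); auto.
    + intros i j hi hj; rewrite h, e by assumption; unfold Msum; simpl.
      rewrite Nat.ltb_irrefl; f_equal; apply Csum_ext; intros a ha.
      apply Nat.ltb_lt in ha; rewrite ha; reflexivity.
Qed.

Lemma psd_normalize n A :
  (1 <= n)%nat -> psd n A ->
  exists B, density n B /\ mat_eq n A (fun i j => trace n A * B i j)%C.
Proof.
  intros hn h; pose proof (psd_trace_real n A h) as e.
  pose proof (psd_trace_nonneg n A h) as pos.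
  destruct (Req_dec (Re (trace n A)) 0) as [z|nz].
  (* Trace zero forces A = 0, so any density matrix serves; [1 <= n] guarantees that one exists. *)
  - exists (outer (basisv 0) (basisv 0)); split; [apply density_outer, unitv_basisv; lia|].
    intros i j hi hj; rewrite (psd_trace_eq0 n A h z) by assumption.
    rewrite e, z; unfold zerom; apply C_eq; simpl; ring.
  - exists (fun i j => RC (/ Re (trace n A)) * A i j)%C; split; [split|].
    + apply psd_scale; [|exact h]; left; apply Rinv_0_lt_compat; lra.
    + rewrite trace_scale, e, <- RC_mul; simpl; rewrite Rinv_l by exact nz; reflexivity.
    + intros i j hi hj; rewrite e; simpl Re.
      replace (RC (Re (trace n A)) * (RC (/ Re (trace n A)) * A i j))%C
        with (RC (Re (trace n A)) * RC (/ Re (trace n A)) * A i j)%C by ring.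
      rewrite <- RC_mul, Rinv_r by exact nz; apply C_eq; simpl; ring.
Qed.

Lemma prodmat_normalize m d rho :
  (forall k, (k < m)%nat -> (1 <= d k)%nat) ->
  (forall k, (k < m)%nat -> psd (d k) (rho k)) ->
  exists q tau, 0 <= q /\ (forall k, (k < m)%nat -> density (d k) (tau k)) /\
    forall i j, prodmat m d rho i j = (RC q * prodmat m d tau i j)%C.
Proof.
  intros hd h.
  destruct (Cprod_nonneg m (fun k => trace (d k) (rho k))) as [q [hq e]].
  { intros k hk; exists (Re (trace (d k) (rho k))); split.
    - apply psd_trace_nonneg; auto.
    - apply psd_trace_real; auto. }
  (* Finite choice by induction on the number of parties; the scalar q is the product of the local
     traces. *)
  assert (ht : exists tau, forall k, (k < m)%nat -> density (d k) (tau k) /\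
            mat_eq (d k) (rho k) (fun i j => trace (d k) (rho k) * tau k i j)%C).
  { clear e; induction m; [exists (fun _ => zerom); lia|].
    destruct IHm as [tau htau]; [auto with arith..|].
    destruct (psd_normalize (d m) (rho m)) as [B hB]; [auto with arith..|].
    exists (slot m B tau); intros k hk; unfold slot.
    destruct (Nat.eqb_spec k m) as [->|]; [exact hB|apply htau; lia]. }
  destruct ht as [tau ht]; exists q, tau; split; [exact hq|split].
  - intros; apply ht; assumption.
  - intros i j; rewrite <- e; unfold prodmat; rewrite <- Cprod_mul.
    apply Cprod_ext; intros k hk; apply (ht k hk); apply digit_lt; auto.
Qed.

Lemma prodmat_trace_density m d tau :
  (forall k, (k < m)%nat -> density (d k) (tau k)) ->
  trace (dimH m d) (prodmat m d tau) = C1.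
Proof.
  intro h; rewrite prodmat_trace, <- (Cprod_one m); apply Cprod_ext; intros; apply h; assumption.
Qed.

(** Normalising each product term gives weights q_j; every normalised term has trace one, so the q_j
    add up to T and the q_j / T are probabilities. *)
Lemma sep_cone_separable m d W T :
  (forall k, (k < m)%nat -> (1 <= d k)%nat) -> sep_cone m d W ->
  trace (dimH m d) W = RC T -> 0 < T ->
  separable m d (fun i j => RC (/ T) * W i j)%C.
Proof.
  intros hd hW eT hT; destruct (sep_cone_explicit m d W hW) as [K [rho [hrho e]]].
  assert (hn : exists q tau, forall j, (j < K)%nat -> 0 <= q j /\
     (forall k, (k < m)%nat -> density (d k) (tau j k)) /\
     forall x y, prodmat m d (rho j) x y = (RC (q j) * prodmat m d (tau j) x y)%C).
  { clear e; induction K; [exists (fun _ => 0), (fun _ _ => zerom); lia|].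
    destruct IHK as [q [tau h]]; [auto with arith|].
    destruct (prodmat_normalize m d (rho K)) as [q' [tau' h']]; [auto with arith..|].
    exists (fun j => if Nat.eqb j K then q' else q j).
    exists (fun j => if Nat.eqb j K then tau' else tau j).
    intros j hj; destruct (Nat.eqb_spec j K) as [->|]; [exact h'|apply h; lia]. }
  destruct hn as [q [tau h]].
  exists K, (fun j => / T * q j), tau; split; [|split; [|split]].
  - intros j hj; apply Rmult_le_pos; [left; apply Rinv_0_lt_compat; exact hT|apply h, hj].
  - rewrite Rsum_mul_l; enough (e2 : Rsum K q = T) by (rewrite e2; field; lra).
    enough (e2 : RC (Rsum K q) = RC T) by (apply (f_equal Re) in e2; exact e2).
    rewrite <- eT, (trace_ext _ _ _ e), trace_Msum, <- Csum_RC; apply Csum_ext; intros j hj.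
    transitivity (trace (dimH m d) (fun x y => RC (q j) * prodmat m d (tau j) x y)%C).
    + rewrite trace_scale, prodmat_trace_density by (apply h, hj); apply C_eq; simpl; ring.
    + apply trace_ext; intros x y _ _; symmetry; apply h, hj.
  - intros j k hj hk; apply h; assumption.
  - intros x y hx hy; rewrite e by assumption; unfold Msum; rewrite <- Csum_mul_l.
    apply Csum_ext; intros j hj; destruct (h j hj) as [_ [_ ->]]; rewrite RC_mul; ring.
Qed.

Lemma separable_ext m d V W : mat_eq (dimH m d) W V -> separable m d V -> separable m d W.
Proof.
  intros e [K [p [rho [h1 [h2 [h3 h4]]]]]]; exists K, p, rho; repeat split; try assumption.
  - intros; apply h3; assumption.
  - intros v; apply h3; assumption.
  - apply h3; assumption.
  - intros i j hi hj; rewrite e by assumption; apply h4; assumption.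
Qed.

(** * Effects and robustness *)

Lemma eigendecomp_form n A mu u x y :
  eigendecomp n A mu u ->
  form n A x y = Csum n (fun k => RC (mu k) * (inner n x (u k) * inner n (u k) y))%C.
Proof.
  intros [_ h]; rewrite (form_ext _ _ _ _ _ h).
  rewrite (form_Msum n n (fun k i j => RC (mu k) * outer (u k) (u k) i j)%C).
  apply Csum_ext; intros; rewrite form_scale, form_outer; reflexivity.
Qed.

Lemma eigendecomp_form_self n A mu u x :
  eigendecomp n A mu u ->
  Re (form n A x x) = Rsum n (fun k => mu k * Cnorm2 (inner n (u k) x)).
Proof.
  intro h; rewrite (eigendecomp_form n A mu u) by exact h.
  rewrite Re_Csum; apply Rsum_ext; intros k _.
  rewrite Re_RC_mul, <- (inner_conj n (u k) x); unfold Cnorm2; simpl; ring.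
Qed.

Lemma Cnorm2_C1 : Cnorm2 C1 = 1.
Proof. unfold Cnorm2; simpl; ring. Qed.

Lemma Cnorm2_C0 : Cnorm2 C0 = 0.
Proof. unfold Cnorm2; simpl; ring. Qed.

Lemma eigendecomp_value n A mu u k :
  eigendecomp n A mu u -> (k < n)%nat -> mu k = Re (form n A (u k) (u k)).
Proof.
  intros h hk; rewrite (eigendecomp_form_self n A mu u) by exact h.
  transitivity (Re (Csum n (fun l => RC (if Nat.eqb l k then mu k else 0)))).
  - rewrite (Csum_single _ _ k hk); [rewrite Nat.eqb_refl; reflexivity|].
    intros i _ ne; destruct (Nat.eqb_spec i k); [contradiction|reflexivity].
  - rewrite Csum_RC; apply Rsum_ext; intros l hl; destruct h as [h _]; rewrite h by assumption.
    destruct (Nat.eqb_spec l k) as [->|]; rewrite ?Cnorm2_C1, ?Cnorm2_C0; ring.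
Qed.

Lemma psd_eigenvalue_nonneg n A mu u k :
  psd n A -> eigendecomp n A mu u -> (k < n)%nat -> 0 <= mu k.
Proof. intros h e hk; rewrite (eigendecomp_value n A mu u k e hk); apply h. Qed.

(** By completeness the same vectors diagonalise the identity with all eigenvalues 1. *)
Lemma parseval n A mu u x :
  eigendecomp n A mu u -> Rsum n (fun k => Cnorm2 (inner n (u k) x)) = Re (inner n x x).
Proof.
  intros [h _].
  assert (e : eigendecomp n idm (fun _ => 1) u).
  { split; [exact h|]; intros i j hi hj; unfold idm.
    rewrite <- (Spectral.orthonormal_complete n u h i j hi hj).
    apply Csum_ext; intros; unfold outer; apply C_eq; simpl; ring. }
  rewrite <- form_idm, (eigendecomp_form_self n idm (fun _ => 1) u) by exact e.
  apply Rsum_ext; intros; ring.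
Qed.

Lemma trace_mmul_eigendecomp n Q A mu u :
  eigendecomp n A mu u ->
  Re (trace n (mmul n Q A)) = Rsum n (fun k => mu k * Re (form n Q (u k) (u k))).
Proof.
  intros [_ h].
  transitivity (Re (Csum n (fun k => RC (mu k) * form n Q (u k) (u k))%C)).
  - f_equal; rewrite (trace_ext n _ (Msum n (fun k i j =>
      RC (mu k) * mmul n Q (outer (u k) (u k)) i j)%C)).
    + rewrite trace_Msum; apply Csum_ext; intros.
      rewrite trace_scale, mmul_outer_trace; reflexivity.
    + intros i j hi hj; unfold mmul, Msum.
      transitivity (Csum n (fun k => Csum n (fun l =>
        RC (mu l) * (Q i k * outer (u l) (u l) k j))%C)).
      * apply Csum_ext; intros; rewrite h by assumption; rewrite <- Csum_mul_l.
        apply Csum_ext; intros; ring.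
      * rewrite Csum_swap; apply Csum_ext; intros; apply Csum_mul_l.
  - rewrite Re_Csum; apply Rsum_ext; intros; apply Re_RC_mul.
Qed.

(* Each eigenvector of [s] with nonzero eigenvalue lies in the range of [s],
   which [Q] annihilates. *)
Lemma psd_orthogonal_support n Q s psi y :
  psd n Q -> psd n s -> Re (trace n (mmul n Q s)) = 0 -> in_support n s psi ->
  form n Q y psi = C0.
Proof.
  intros hQ hs e [K [c [u [hu hpsi]]]].
  destruct (Spectral.exists_eigendecomp n s (proj1 hs)) as [mu [w hw]].
  rewrite (trace_mmul_eigendecomp n Q s mu w hw) in e.
  (* The trace is a sum of nonnegative terms mu_k <w_k|Q w_k>, so for each k either mu_k = 0 or Q
     annihilates w_k. *)
  assert (z : forall k x, (k < n)%nat -> (RC (mu k) * form n Q x (w k))%C = C0).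
  { intros k x hk.
    assert (ek : mu k * Re (form n Q (w k) (w k)) = 0).
    { apply (Rsum_eq0_term n (fun k => mu k * Re (form n Q (w k) (w k)))); try assumption.
      intros j hj; apply Rmult_le_pos; [apply (psd_eigenvalue_nonneg n s mu w); assumption|].
      apply hQ. }
    apply Rmult_integral in ek; destruct ek as [ek|ek].
    - rewrite ek; apply C_eq; simpl; ring.
    - rewrite (psd_form_eq0 n Q x (w k) hQ ek); ring. }
  rewrite (form_ext_r _ _ _ _ _ hpsi), form_sum_r; apply Csum_eq0; intros j hj.
  destruct (hu j hj) as [lam [nlam el]].
  enough (e2 : form n Q y (u j) = C0) by (rewrite e2; ring).
  (* It is enough to treat [lam] times [u j], which is [s] applied to [u j] and expands in the [w k]
     with a factor [mu k]. The one-term [Csum] puts a scalar multiple in the shape of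
     [form_sum_r]. *)
  apply (Cmul_eq0 lam); [|exact nlam].
  transitivity (form n Q y (fun i => Csum 1 (fun _ => lam * u j i)%C)).
  - rewrite (form_sum_r n Q 1 y (fun _ => lam) (fun _ => u j)); cbn [Csum]; ring.
  - transitivity (form n Q y (fun i =>
      Csum n (fun k => (RC (mu k) * inner n (w k) (u j)) * w k i)%C)).
    + apply form_ext_r; intros i hi; cbn [Csum].
      transitivity (apply n s (u j) i); [rewrite el by exact hi; ring|].
      rewrite <- (inner_basisv n i (apply n s (u j)) hi).
      change (form n s (basisv i) (u j) =
              Csum n (fun k => (RC (mu k) * inner n (w k) (u j)) * w k i)%C).
      rewrite (eigendecomp_form n s mu w) by exact hw; apply Csum_ext; intros.
      rewrite inner_basisv by exact hi; ring.
    + rewrite form_sum_r; apply Csum_eq0; intros k hk.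
      transitivity (inner n (w k) (u j) * (RC (mu k) * form n Q y (w k)))%C; [ring|].
      rewrite z by exact hk; ring.
Qed.

(** I - Pi_i is the sum of the other effects, hence positive, and its trace against [s] is 1 - 1 =
    0; so it annihilates the support of [s]. *)
Lemma effect_fixes_support m d N p i s psi y :
  (forall k, (k < m)%nat -> (1 <= d k)%nat) -> valid m d N p -> (i < N)%nat ->
  density (dimH m d) s ->
  trace (dimH m d) (mmul (dimH m d) (effect m d p i) s) = C1 ->
  in_support (dimH m d) s psi ->
  form (dimH m d) (effect m d p i) y psi = inner (dimH m d) y psi.
Proof.
  intros hd hp hi [hs ts] e hpsi; set (n := dimH m d) in *.
  pose (Q := fun a b => (idm a b + RC (-1) * effect m d p i a b)%C).
  assert (fQ : forall x z, form n Q x z = (inner n x z - form n (effect m d p i) x z)%C).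
  { intros x z; unfold Q; rewrite form_add, form_scale, form_idm; apply C_eq; simpl; ring. }
  assert (hQ : psd n Q).
  { split.
    - intros a b ha hb; unfold Q; rewrite Cconj_add, Cconj_mul, Cconj_RC.
      rewrite <- (proj1 (psd_idm n)), <- (proj1 (effect_psd m d p i)) by assumption; reflexivity.
    - intro v; change (0 <= Re (form n Q v v)); rewrite fQ, <- form_idm; simpl.
      rewrite <- (form_ext n _ _ v v (effect_complete m d N p hd hp)).
      rewrite form_Msum, Re_Csum.
      pose proof (Rsum_ge_term N (fun j => Re (form n (effect m d p j) v v)) i) as g.
      assert (forall j, (j < N)%nat -> 0 <= Re (form n (effect m d p j) v v)).
      { intros; apply effect_psd. }
      specialize (g H hi); lra. }
  assert (z : form n Q y psi = C0).
  { apply (psd_orthogonal_support n Q s); try assumption.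
    enough (eQ : trace n (mmul n Q s) =
                 (trace n s + RC (-1) * trace n (mmul n (effect m d p i) s))%C).
    { rewrite eQ, ts, e; simpl; ring. }
    unfold trace; rewrite <- Csum_mul_l, <- Csum_add; apply Csum_ext; intros a ha.
    rewrite <- (mmul_idm_l n s a a ha); unfold mmul, Q.
    rewrite <- Csum_mul_l, <- Csum_add; apply Csum_ext; intros; ring. }
  rewrite fQ in z; transitivity (inner n y psi - C0)%C; [rewrite <- z|]; ring.
Qed.

Lemma psd_sub_outer n A psi :
  psd n A -> unitv n psi -> (forall y, form n A y psi = inner n y psi) ->
  psd n (fun i j => A i j + RC (-1) * outer psi psi i j)%C.
Proof.
  intros h hpsi e; split.
  - intros i j hi hj; rewrite Cconj_add, Cconj_mul, Cconj_RC.
    rewrite <- (proj1 h), <- (proj1 (psd_outer n psi)) by assumption; reflexivity.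
  - intro v; change (0 <= Re (form n (fun i j => A i j + RC (-1) * outer psi psi i j)%C v v)).
    rewrite form_add, form_scale, form_outer, <- (inner_conj n v psi), Cmul_conj.
    pose proof (psd_cauchy_schwarz n A v psi h) as cs.
    rewrite !e, hpsi in cs; simpl in *; lra.
Qed.

(** W - |psi><psi| is positive of trace T - 1; normalised, it is the density matrix that is mixed
    in, and dividing by 1 + (T - 1) = T returns the separable state W / T. *)
Lemma Rg_feasible_effect m d W psi T :
  (forall k, (k < m)%nat -> (1 <= d k)%nat) -> sep_cone m d W -> psd (dimH m d) W ->
  trace (dimH m d) W = RC T -> unitv (dimH m d) psi ->
  (forall y, form (dimH m d) W y psi = inner (dimH m d) y psi) ->
  Rg_feasible m d (outer psi psi) (T - 1).
Proof.
  intros hd hc hW eT hpsi e; set (n := dimH m d) in *.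
  set (V := (fun i j => W i j + RC (-1) * outer psi psi i j)%C).
  assert (hV : psd n V) by (apply psd_sub_outer; assumption).
  assert (eV : trace n V = RC (T - 1)).
  { unfold V; rewrite trace_add, trace_scale, trace_outer, hpsi, eT; apply C_eq; simpl; ring. }
  pose proof (psd_trace_nonneg n V hV) as pos; rewrite eV in pos; simpl in pos.
  split; [exact pos|].
  assert (hn : (1 <= n)%nat) by (apply prodd_pos; exact hd).
  destruct (psd_normalize n V hn hV) as [B [hB eB]].
  exists B; split; [exact hB|].
  apply (separable_ext m d (fun i j => RC (/ T) * W i j)%C).
  - intros i j hi hj; replace (1 + (T - 1)) with T by ring; f_equal.
    rewrite <- eV, <- (eB i j hi hj); unfold V; apply C_eq; simpl; ring.
  - apply sep_cone_separable; try assumption; lra.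
Qed.

(** * Relative entropy of pure states *)

(** The tangent line at the mean S gives ln x <= ln S - 1 + x / S, which is averaged over p. Where p
    vanishes, x may be any real, which accommodates zero eigenvalues. *)
Lemma jensen_ln n p x :
  (forall l, (l < n)%nat -> 0 <= p l) -> Rsum n p = 1 ->
  (forall l, (l < n)%nat -> 0 < p l -> 0 < x l) ->
  0 < Rsum n (fun l => p l * x l) /\
  Rsum n (fun l => p l * ln (x l)) <= ln (Rsum n (fun l => p l * x l)).
Proof.
  intros hp sp hx.
  assert (t : forall l, (l < n)%nat -> 0 <= p l * x l).
  { intros l hl; destruct (Rle_lt_or_eq_dec 0 (p l) (hp l hl)) as [q|q].
    - apply Rmult_le_pos; [lra|left; auto].
    - rewrite <- q; lra. }
  set (S := Rsum n (fun l => p l * x l)).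
  assert (hS : 0 < S).
  { destruct (Rle_lt_or_eq_dec 0 S (Rsum_nonneg n _ t)) as [|z]; [assumption|exfalso].
    enough (Rsum n p = 0) by lra.
    rewrite <- (Rsum_zero n); apply Rsum_ext; intros l hl.
    pose proof (Rsum_eq0_term n _ l t (eq_sym z) hl) as w; simpl in w.
    apply Rmult_integral in w; destruct w as [w|w]; [exact w|].
    destruct (Rle_lt_or_eq_dec 0 (p l) (hp l hl)) as [q|q]; [|lra].
    specialize (hx l hl q); lra. }
  split; [exact hS|].
  enough (h : Rsum n (fun l => p l * ln (x l)) <=
              Rsum n (fun l => (ln S - 1) * p l + / S * (p l * x l))).
  { rewrite Rsum_add, !Rsum_mul_l, sp in h; fold S in h; rewrite Rinv_l in h; lra. }
  apply Rsum_le; intros l hl.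
  destruct (Rle_lt_or_eq_dec 0 (p l) (hp l hl)) as [q|q]; [|rewrite <- q; lra].
  specialize (hx l hl q).
  assert (pos : 0 < x l * / S) by (apply Rmult_lt_0_compat; [lra|apply Rinv_0_lt_compat; lra]).
  pose proof (exp_ineq1_le (ln (x l * / S))) as i; rewrite exp_ln in i by exact pos.
  rewrite ln_mult, ln_Rinv in i by (try apply Rinv_0_lt_compat; assumption).
  assert (p l * (1 + (ln (x l) + - ln S)) <= p l * (x l * / S))
    by (apply Rmult_le_compat_l; lra).
  lra.
Qed.

Lemma pure_expectation n psi mu u :
  eigendecomp n (outer psi psi) mu u -> forall x,
  Rsum n (fun k => mu k * Cnorm2 (inner n (u k) x)) = Cnorm2 (inner n x psi).
Proof.
  intros hu x; rewrite <- (eigendecomp_form_self n (outer psi psi)) by exact hu.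
  rewrite form_outer, <- (inner_conj n x psi), Cmul_conj; reflexivity.
Qed.

(** mu_k = |<u_k|psi>|^2, so the mu_k sum to 1, and so do their squares since <psi|psi> = 1. Hence
    the nonnegative terms mu_k (1 - mu_k) sum to zero. *)
Lemma pure_eigenvalue n psi mu u :
  unitv n psi -> eigendecomp n (outer psi psi) mu u ->
  forall k, (k < n)%nat -> mu k = 0 \/ mu k = 1.
Proof.
  intros hpsi hu k.
  assert (e : forall k, (k < n)%nat -> mu k = Cnorm2 (inner n (u k) psi)).
  { intros l hl; rewrite (eigendecomp_value n (outer psi psi) mu u l hu hl).
    rewrite form_outer, <- (inner_conj n (u l) psi), Cmul_conj; reflexivity. }
  pose proof (parseval n _ mu u psi hu) as s1; rewrite hpsi in s1; simpl in s1.
  pose proof (pure_expectation n psi mu u hu psi) as s2; rewrite hpsi, Cnorm2_C1 in s2.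
  assert (pos : forall j, (j < n)%nat -> 0 <= mu j)
    by (intros; rewrite e by assumption; apply Cnorm2_nonneg).
  rewrite <- (Rsum_ext n mu) in s1 by exact e.
  assert (le1 : forall j, (j < n)%nat -> mu j <= 1).
  { intros; rewrite <- s1; apply Rsum_ge_term; assumption. }
  assert (s3 : Rsum n (fun k => mu k + -1 * (mu k * mu k)) = 0).
  { rewrite Rsum_add, Rsum_mul_l, s1.
    rewrite (Rsum_ext n _ (fun k => mu k * Cnorm2 (inner n (u k) psi))).
    - rewrite s2; ring.
    - intros; rewrite <- e by assumption; reflexivity. }
  intro hk.
  assert (q : mu k * (1 - mu k) = 0).
  { rewrite <- (Rsum_eq0_term n (fun k => mu k + -1 * (mu k * mu k)) k);
      [ring| |exact s3|exact hk].
    intros j hj; specialize (pos j hj); specialize (le1 j hj); nra. }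
  apply Rmult_integral in q; destruct q; [left|right]; lra.
Qed.

(** The entropy term vanishes because each eigenvalue is 0 or 1. In the cross term the sum over k
    recombines into <v_l|psi><psi|v_l>, which removes the dependence on [u]. *)
Lemma pure_rel_entropy n psi mu u :
  unitv n psi -> eigendecomp n (outer psi psi) mu u ->
  forall (lam : nat -> R) v,
  Rsum n (fun k => if Rlt_dec 0 (mu k) then mu k * log2 (mu k) else 0)
  - Rsum n (fun k => Rsum n (fun l =>
      if Rlt_dec 0 (lam l)
      then mu k * Cnorm2 (inner n (u k) (v l)) * log2 (lam l) else 0)) =
  - Rsum n (fun l => if Rlt_dec 0 (lam l)
                     then Cnorm2 (inner n (v l) psi) * log2 (lam l) else 0).
Proof.
  intros hpsi hu lam v; rewrite (Rsum_ext n _ (fun _ => 0)), Rsum_zero, Rsum_swap.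
  - rewrite Rminus_0_l; f_equal; apply Rsum_ext; intros l _.
    destruct (Rlt_dec 0 (lam l)); [|apply Rsum_zero].
    rewrite <- (pure_expectation n psi mu u hu), (Rmult_comm _ (log2 (lam l))), <- Rsum_mul_l.
    apply Rsum_ext; intros; ring.
  - intros k hk; destruct (Rlt_dec 0 (mu k)); [|reflexivity].
    destruct (pure_eigenvalue n psi mu u hpsi hu k hk) as [e|e]; rewrite e; [ring|].
    unfold log2; rewrite ln_1; unfold Rdiv; ring.
Qed.
Lemma ln2_pos : 0 < ln 2.
Proof. rewrite <- ln_1; apply ln_increasing; lra. Qed.

(* Testing [omega >= c psi psi*] on the vector [omega^-1 psi]
   (inverse taken on the support) bounds <psi|omega^-1|psi> by 1/c. *)
Lemma inverse_expectation_le n omega psi lam v c :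
  0 < c -> eigendecomp n omega lam v ->
  (forall x, c * Cnorm2 (inner n psi x) <= Re (form n omega x x)) ->
  Rsum n (fun l => if Rlt_dec 0 (lam l) then Cnorm2 (inner n (v l) psi) * / lam l else 0) <= / c.
Proof.
  intros hc hv dom.
  pose (y := fun l => if Rlt_dec 0 (lam l) then / lam l else 0).
  set (S := Rsum n _).
  assert (eS : S = Rsum n (fun l => y l * Cnorm2 (inner n (v l) psi))).
  { apply Rsum_ext; intros l _; unfold y; destruct Rlt_dec; ring. }
  pose (x := fun i => Csum n (fun l => (RC (y l) * inner n (v l) psi) * v l i)%C).
  assert (e1 : forall k, (k < n)%nat -> inner n (v k) x = (RC (y k) * inner n (v k) psi)%C).
  { intros k hk; unfold x; rewrite inner_sum_r, (Csum_single _ _ k hk).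
    - rewrite (proj1 hv) by assumption; rewrite Nat.eqb_refl; ring.
    - intros l hl ne; rewrite (proj1 hv) by assumption.
      destruct (Nat.eqb_spec k l); [congruence|ring]. }
  assert (e2 : Re (form n omega x x) = S).
  { rewrite (eigendecomp_form_self n omega lam v) by exact hv; rewrite eS.
    apply Rsum_ext; intros k hk; rewrite e1, Cnorm2_mul by exact hk.
    unfold y; destruct Rlt_dec; unfold Cnorm2 at 1; simpl; [field; lra|ring]. }
  assert (e3 : inner n psi x = RC S).
  { unfold x; rewrite inner_sum_r, eS, <- Csum_RC; apply Csum_ext; intros l hl.
    rewrite RC_mul, <- Cmul_conj, (inner_conj n (v l) psi); ring. }
  specialize (dom x); rewrite e2, e3 in dom.
  replace (Cnorm2 (RC S)) with (S * S) in dom by (unfold Cnorm2; simpl; ring).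
  (* [dom] now reads c S^2 <= S; for positive S, dividing by c S gives the claim. *)
  destruct (Rle_dec S 0) as [|pS]; [pose proof (Rinv_0_lt_compat c hc); lra|].
  apply (Rmult_le_reg_l (c * S)); [apply Rmult_lt_0_compat; lra|].
  replace (c * S * / c) with S by (field; lra); lra.
Qed.

(** With weights p_l = |<v_l|psi>|^2, Jensen at the values 1 / lam_l gives -sum p_l log lam_l <= log
    sum p_l / lam_l, and the last sum is at most 1/c. In the application c is 1 / (1 + R). *)
Lemma rel_entropy_pure_upper n omega psi c :
  0 < c -> unitv n psi -> psd n omega ->
  (forall x, c * Cnorm2 (inner n psi x) <= Re (form n omega x x)) ->
  exists x, rel_entropy n (outer psi psi) omega x /\ x <= log2 (/ c).
Proof.
  intros hc hpsi homega dom.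
  destruct (Spectral.exists_eigendecomp n _ (proj1 (psd_outer n psi))) as [mu [u hu]].
  destruct (Spectral.exists_eigendecomp n _ (proj1 homega)) as [lam [v hv]].
  (* Domination tested on [v l] says c p_l <= lam_l, so the relative entropy is finite. *)
  assert (supp : forall l, (l < n)%nat -> 0 < Cnorm2 (inner n (v l) psi) -> 0 < lam l).
  { intros l hl q; specialize (dom (v l)).
    rewrite <- (eigendecomp_value n omega lam v l hv hl) in dom.
    rewrite <- (inner_conj n (v l) psi), Cnorm2_conj in dom.
    apply Rlt_le_trans with (2 := dom); apply Rmult_lt_0_compat; assumption. }
  eexists; split.
  - exists mu, u, lam, v; split; [exact hu|split; [exact hv|split; [|reflexivity]]].
    intros k l hk hl pk q; apply supp; [exact hl|].
    rewrite <- (pure_expectation n psi mu u hu (v l)).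
    apply Rlt_le_trans with (mu k * Cnorm2 (inner n (u k) (v l))).
    + apply Rmult_lt_0_compat; assumption.
    + apply (Rsum_ge_term n (fun k => mu k * Cnorm2 (inner n (u k) (v l)))); [|exact hk].
      intros j hj; apply Rmult_le_pos; [|apply Cnorm2_nonneg].
      apply (psd_eigenvalue_nonneg n (outer psi psi) mu u); [apply psd_outer|exact hu|exact hj].
  - rewrite (pure_rel_entropy n psi mu u hpsi hu).
    set (p := fun l => Cnorm2 (inner n (v l) psi)).
    (* The default 1 keeps every value positive; it occurs only with weight zero. *)
    pose (x := fun l => if Rlt_dec 0 (lam l) then / lam l else 1).
    assert (p0 : forall l, (l < n)%nat -> ~ 0 < lam l -> p l = 0).
    { intros l hl np; pose proof (Cnorm2_nonneg (inner n (v l) psi)) as q; fold (p l) in q.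
      destruct (Rle_lt_or_eq_dec _ _ q) as [q'|q']; [|auto].
      exfalso; apply np, supp; assumption. }
    destruct (jensen_ln n p x) as [pos J].
    { intros; apply Cnorm2_nonneg. }
    { unfold p; rewrite (parseval n omega lam v) by exact hv; rewrite hpsi; reflexivity. }
    { intros l _ _; unfold x; destruct Rlt_dec; [apply Rinv_0_lt_compat; assumption|lra]. }
    apply Rle_trans with (/ ln 2 * Rsum n (fun l => p l * ln (x l))).
    { right.
      transitivity (-1 * Rsum n (fun l => if Rlt_dec 0 (lam l) then p l * log2 (lam l) else 0));
        [unfold p; ring|].
      rewrite <- !Rsum_mul_l; apply Rsum_ext; intros l hl.
      unfold x; destruct Rlt_dec as [q|q].
      - rewrite ln_Rinv by exact q; unfold log2, Rdiv; ring.
      - rewrite p0 by assumption; ring. }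
    unfold log2, Rdiv; rewrite (Rmult_comm (ln (/ c))); apply Rmult_le_compat_l.
    { left; apply Rinv_0_lt_compat, ln2_pos. }
    apply Rle_trans with (1 := J).
    enough (b : Rsum n (fun l => p l * x l) <= / c).
    { destruct (Rle_lt_or_eq_dec _ _ b) as [b'|b']; [left; apply ln_increasing; assumption|].
      rewrite b'; lra. }
    apply Rle_trans with (2 := inverse_expectation_le n omega psi lam v c hc hv dom).
    right; apply Rsum_ext; intros l hl; fold (p l); unfold x; destruct Rlt_dec as [q|q]; [ring|].
    rewrite p0 by assumption; ring.
Qed.

(** Jensen at the eigenvalues themselves: sum p_l log lam_l <= log sum p_l lam_l, and the last sum
    is <psi|omega|psi>. *)
Lemma rel_entropy_pure_lower n omega psi e :
  unitv n psi -> rel_entropy n (outer psi psi) omega e ->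
  0 < Re (form n omega psi psi) /\ - log2 (Re (form n omega psi psi)) <= e.
Proof.
  intros hpsi [mu [u [lam [v [hu [hv [supp ->]]]]]]].
  rewrite (pure_rel_entropy n psi mu u hpsi hu).
  set (p := fun l => Cnorm2 (inner n (v l) psi)).
  assert (hp : forall l, (l < n)%nat -> 0 <= p l) by (intros; apply Cnorm2_nonneg).
  (* p_l is the sum over k of mu_k |<u_k|v_l>|^2. If lam_l were not positive, the support condition
     would make every term zero. *)
  assert (supp' : forall l, (l < n)%nat -> 0 < p l -> 0 < lam l).
  { intros l hl q; destruct (Rlt_dec 0 (lam l)) as [|np]; [assumption|exfalso].
    unfold p in q; rewrite <- (pure_expectation n psi mu u hu (v l)) in q.
    rewrite (Rsum_ext n _ (fun _ => 0)), Rsum_zero in q; [lra|]; intros k hk.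
    pose proof (psd_eigenvalue_nonneg n _ mu u k (psd_outer n psi) hu hk) as pk.
    pose proof (Cnorm2_nonneg (inner n (u k) (v l))) as pn.
    destruct (Rle_lt_or_eq_dec _ _ pk) as [pk'|pk']; [|rewrite <- pk'; ring].
    destruct (Rle_lt_or_eq_dec _ _ pn) as [pn'|pn']; [|rewrite <- pn'; ring].
    exfalso; apply np, (supp k l); assumption. }
  assert (eS : Re (form n omega psi psi) = Rsum n (fun l => p l * lam l)).
  { rewrite (eigendecomp_form_self n omega lam v) by exact hv.
    apply Rsum_ext; intros; unfold p; ring. }
  destruct (jensen_ln n p lam) as [pos J]; [exact hp| |exact supp'|].
  { unfold p; rewrite (parseval n omega lam v) by exact hv; rewrite hpsi; reflexivity. }
  rewrite <- eS in pos, J; split; [exact pos|].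
  change (- log2 (Re (form n omega psi psi)) <=
          - Rsum n (fun l => if Rlt_dec 0 (lam l) then p l * log2 (lam l) else 0)).
  replace (Rsum n (fun l => if Rlt_dec 0 (lam l) then p l * log2 (lam l) else 0))
    with (/ ln 2 * Rsum n (fun l => p l * ln (lam l))).
  - unfold log2, Rdiv; rewrite Rmult_comm; apply Ropp_le_contravar.
    apply Rmult_le_compat_l; [left; apply Rinv_0_lt_compat, ln2_pos|exact J].
  - rewrite <- Rsum_mul_l; apply Rsum_ext; intros l hl; destruct Rlt_dec as [q|q].
    + unfold log2, Rdiv; ring.
    + enough (e0 : p l = 0) by (rewrite e0; ring).
      destruct (Rle_lt_or_eq_dec _ _ (hp l hl)) as [q'|q']; [|auto].
      exfalso; apply q, supp'; assumption.
Qed.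

(** * Geometric measure and conclusion *)

Lemma density_spectral n A :
  density n A -> exists mu u,
    (forall k, (k < n)%nat -> 0 <= mu k) /\ Rsum n mu = 1 /\
    (forall k, (k < n)%nat -> unitv n (u k)) /\
    mat_eq n A (fun i j => Csum n (fun k => RC (mu k) * outer (u k) (u k) i j)%C).
Proof.
  intros [hA tA]; destruct (Spectral.exists_eigendecomp n A (proj1 hA)) as [mu [u h]].
  assert (hu : forall k, (k < n)%nat -> unitv n (u k)).
  { intros k hk; unfold unitv; rewrite (proj1 h) by assumption; rewrite Nat.eqb_refl; reflexivity. }
  exists mu, u; repeat split; [|..|exact hu|apply h].
  - intros; apply (psd_eigenvalue_nonneg n A mu u); assumption.
  - assert (e : trace n A = RC (Rsum n mu)).
    { rewrite (trace_ext n _ (Msum n (fun k i j => RC (mu k) * outer (u k) (u k) i j)%C) (proj2 h)).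
      rewrite trace_Msum.
      rewrite <- Csum_RC; apply Csum_ext; intros k hk.
      rewrite trace_scale, trace_outer, (hu k hk); apply C_eq; simpl; ring. }
    rewrite tA in e; apply (f_equal Re) in e; symmetry; exact e.
Qed.

(* The local density matrices are replaced by unit vectors one party at a time:
   [j] is the number of parties still in a mixed state. *)
Lemma partially_pure_expectation_le m d psi g rho j :
  (forall k, (k < m)%nat -> (1 <= d k)%nat) ->
  (forall phi, (forall k, (k < m)%nat -> unitv (d k) (phi k)) ->
     Cnorm2 (inner (dimH m d) (prodvec m d phi) psi) <= g) ->
  (j <= m)%nat -> (forall k, (k < j)%nat -> density (d k) (rho k)) ->
  forall phi, (forall k, (k < m)%nat -> unitv (d k) (phi k)) ->
  Re (form (dimH m d)
    (prodmat m d (fun k => if Nat.ltb k j then rho k else outer (phi k) (phi k))) psi psi) <= g.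
Proof.
  intros hd hg; induction j as [|j IH]; intros hj hrho phi hphi.
  - rewrite (form_ext _ _ (outer (prodvec m d phi) (prodvec m d phi))).
    + rewrite form_outer, <- (inner_conj _ (prodvec m d phi) psi).
      replace (Re _) with (Cnorm2 (inner (dimH m d) (prodvec m d phi) psi))
        by (unfold Cnorm2; simpl; ring).
      apply hg, hphi.
    + intros x y _ _; apply prodmat_outer.
  - destruct (density_spectral (d j) (rho j)) as [mu [u [hmu [smu [hu e]]]]]; [auto with arith|].
    set (tau := fun k => if Nat.ltb k j then rho k else outer (phi k) (phi k)).
    (* The expectation is linear in slot [j], hence an average over the eigenprojectors of [rho j];
       the induction hypothesis bounds each term, with [u a] as the vector of party [j]. *)
    rewrite (form_ext _ _ (Msum (d j) (fun a x y =>
      RC (mu a) * prodmat m d (slot j (outer (u a) (u a)) tau) x y)%C)).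
    + rewrite form_Msum, Re_Csum, <- (Rmult_1_r g), <- smu, <- Rsum_mul_l.
      apply Rsum_le; intros a ha; rewrite form_scale, Re_RC_mul, (Rmult_comm g).
      apply Rmult_le_compat_l; [auto|].
      rewrite (form_ext _ _ (prodmat m d (fun k => if Nat.ltb k j then rho k else
        outer (if Nat.eqb k j then u a else phi k) (if Nat.eqb k j then u a else phi k)))).
      * apply (IH ltac:(lia) ltac:(auto with arith) (fun k => if Nat.eqb k j then u a else phi k)).
        intros k hk; destruct (Nat.eqb_spec k j) as [->|]; auto.
      * intros x y _ _; apply prodmat_ext; [exact hd|]; intros k hk p q _ _.
        unfold slot, tau; destruct (Nat.eqb_spec k j) as [->|]; [|reflexivity].
        rewrite Nat.ltb_irrefl; reflexivity.
    + intros x y _ _; unfold Msum; rewrite <- prodmat_slot_sum by lia.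
      apply prodmat_ext; [exact hd|]; intros k hk p q hp hq; unfold slot, tau.
      destruct (Nat.eqb_spec k j) as [->|ne].
      * destruct (Nat.ltb_spec j (S j)); [auto|lia].
      * destruct (Nat.ltb_spec k (S j)), (Nat.ltb_spec k j); try reflexivity; lia.
Qed.

Lemma separable_expectation_le m d psi g omega :
  (forall k, (k < m)%nat -> (1 <= d k)%nat) ->
  (forall phi, (forall k, (k < m)%nat -> unitv (d k) (phi k)) ->
     Cnorm2 (inner (dimH m d) (prodvec m d phi) psi) <= g) ->
  separable m d omega -> Re (form (dimH m d) omega psi psi) <= g.
Proof.
  intros hd hg [K [p [rho [hp [sp [hrho e]]]]]].
  rewrite (form_ext _ _ (Msum K (fun j a b => RC (p j) * prodmat m d (rho j) a b)%C) _ _ e).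
  rewrite form_Msum, Re_Csum, <- (Rmult_1_r g), <- sp, <- Rsum_mul_l; apply Rsum_le; intros j hj.
  rewrite form_scale, Re_RC_mul, (Rmult_comm g); apply Rmult_le_compat_l; [auto|].
  (* All parties start in a mixed state, so the vector family is a placeholder; [basisv 0] is a unit
     vector because every local dimension is positive. *)
  rewrite (form_ext _ _ (prodmat m d
    (fun k => if Nat.ltb k m then rho j k else outer (basisv 0) (basisv 0)))).
  - apply (partially_pure_expectation_le m d psi g (rho j) m hd hg (le_n m) (fun k => hrho j k hj)
             (fun _ => basisv 0)).
    intros k hk; apply unitv_basisv, hd, hk.
  - intros x y _ _; apply prodmat_ext; [exact hd|]; intros k hk a b _ _.
    apply Nat.ltb_lt in hk; rewrite hk; reflexivity.
Qed.

Lemma Eg_le_ER m d psi e g :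
  (forall k, (k < m)%nat -> (1 <= d k)%nat) -> unitv (dimH m d) psi ->
  is_ER m d psi e -> is_Eg m d psi g -> g <= e.
Proof.
  intros hd hpsi [[w [_ [hw he]]] _] [G [_ [hG ->]]].
  destruct (rel_entropy_pure_lower (dimH m d) w psi e hpsi he) as [pos le].
  pose proof (separable_expectation_le m d psi G w hd hG hw) as b.
  apply Rle_trans with (2 := le); apply Ropp_le_contravar; unfold log2.
  apply Rmult_le_compat_r; [left; apply Rinv_0_lt_compat, ln2_pos|].
  destruct (Rle_lt_or_eq_dec _ _ b) as [b'|b']; [left; apply ln_increasing; assumption|].
  rewrite b'; lra.
Qed.

(** The separable mixture that attains the robustness is a candidate in the minimum defining E_R,
    and it dominates |psi><psi| / (1 + r). *)
Lemma ER_le_log_robustness m d psi r e :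
  unitv (dimH m d) psi -> is_R m d psi r -> is_ER m d psi e -> e <= log2 (1 + r).
Proof.
  intros hpsi [[hr [B [hB hs]]] _] [_ he]; set (n := dimH m d) in *.
  assert (hc : 0 < / (1 + r)) by (apply Rinv_0_lt_compat; lra).
  set (w := fun a b => (RC (/ (1 + r)) * (outer psi psi a b + RC r * B a b))%C) in hs.
  assert (pw : psd n w).
  { apply psd_scale; [lra|]; apply psd_add; [apply psd_outer|].
    apply psd_scale; [exact hr|apply hB]. }
  assert (dw : density n w).
  { split; [exact pw|]; unfold w.
    rewrite trace_scale, trace_add, trace_scale, trace_outer, hpsi, (proj2 hB).
    apply C_eq; simpl; field; lra. }
  destruct (rel_entropy_pure_upper n w psi (/ (1 + r)) hc hpsi pw) as [x [hx le]].
  - intro y; unfold w; rewrite form_scale, Re_RC_mul, form_add, form_scale.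
    apply Rmult_le_compat_l; [lra|].
    change (Cnorm2 (inner n psi y) <=
            Re (form n (outer psi psi) y y) + Re (RC r * form n B y y)%C).
    rewrite Re_RC_mul, form_outer, <- (inner_conj n psi y).
    replace (Re (Cconj (inner n psi y) * inner n psi y)%C) with (Cnorm2 (inner n psi y))
      by (unfold Cnorm2; simpl; ring).
    pose proof (proj2 (proj1 hB) y) as pB; fold (form n B y y) in pB.
    pose proof (Rmult_le_pos _ _ hr pB); lra.
  - rewrite Rinv_inv in le; apply Rle_trans with (2 := le); apply (he w x dw hs hx).
Qed.

(** * Assembling the chain of bounds *)

Lemma Rpower_2_log2 x : 0 < x -> Rpower 2 (log2 x) = x.
Proof.
  intro h; unfold Rpower, log2; replace (ln x / ln 2 * ln 2) with (ln x).
  - apply exp_ln, h.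
  - field; pose proof ln2_pos; lra.
Qed.

Lemma bounds_of_pointwise m d N r e g :
  (1 <= N)%nat ->
  (forall i, (i < N)%nat -> 0 <= r i) ->
  Rsum N (fun i => 1 + r i) <= INR (dimH m d) ->
  (forall i, (i < N)%nat -> Rpower 2 (e i) <= 1 + r i) ->
  (forall i, (i < N)%nat -> g i <= e i) ->
  bounds m d N r e g.
Proof.
  intros hN hr hD her hge; unfold bounds, avg; set (D := INR (dimH m d)) in *.
  assert (pN : 0 < INR N) by (apply lt_0_INR; lia).
  set (A := Rsum N (fun i => 1 + r i)) in *; set (B := Rsum N (fun i => Rpower 2 (e i))).
  set (G := Rsum N (fun i => Rpower 2 (g i))).
  assert (pG : 0 < G).
  (* The term of index 0 exists since [1 <= N]; positivity of [G] then passes to [B] and [A]. *)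
  { apply Rlt_le_trans with (Rpower 2 (g 0%nat)); [apply exp_pos|].
    apply (Rsum_ge_term N (fun i => Rpower 2 (g i))); [|lia]; intros; left; apply exp_pos. }
  assert (GB : G <= B).
  { apply Rsum_le; intros; apply Rle_Rpower; [lra|auto]. }
  assert (BA : B <= A) by (apply Rsum_le; auto).
  assert (anti : forall X Y, 0 < X -> X <= Y -> D / (Y / INR N) <= D / (X / INR N)).
  { intros X Y pX le; apply Rmult_le_compat_l; [lra|].
    apply Rinv_le_contravar.
    - apply Rmult_lt_0_compat; [exact pX|apply Rinv_0_lt_compat; exact pN].
    - apply Rmult_le_compat_r; [left; apply Rinv_0_lt_compat; exact pN|exact le]. }
  split; [|split; apply anti; lra].
  (* The first bound is N times D / A >= 1, that is, A <= D. *)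
  replace (D / (A / INR N)) with (INR N * (D * / A)) by (field; lra).
  rewrite <- (Rmult_1_r (INR N)) at 1; apply Rmult_le_compat_l; [lra|].
  apply (Rmult_le_reg_r A); [lra|]; rewrite Rmult_assoc, Rinv_l by lra; lra.
Qed.

(** Tr Pi_i - 1 is feasible for psi_i, so minimality gives 1 + r_i <= Tr Pi_i, and the traces add up
    to Tr I = D. *)
Lemma robustness_sum_le m d N sigma psi r :
  (forall k, (k < m)%nat -> (1 <= d k)%nat) ->
  (forall i, (i < N)%nat -> density (dimH m d) (sigma i)) ->
  LOCC_distinguishable m d N sigma ->
  (forall i, (i < N)%nat -> unitv (dimH m d) (psi i) /\
     in_support (dimH m d) (sigma i) (psi i) /\ is_R m d (psi i) (r i)) ->
  Rsum N (fun i => 1 + r i) <= INR (dimH m d).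
Proof.
  intros hd hs [p [hp htr]] h; set (n := dimH m d) in *.
  replace (INR n) with (Rsum N (fun i => Re (trace n (effect m d p i)))).
  - apply Rsum_le; intros i hi; destruct (h i hi) as [hu [hsup [_ hmin]]].
    enough (r i <= Re (trace n (effect m d p i)) - 1) by lra.
    apply hmin, (Rg_feasible_effect m d (effect m d p i)); try assumption.
    + apply (effect_sep_cone m d N); exact hp.
    + apply effect_psd.
    + apply psd_trace_real, effect_psd.
    + intro y; apply (effect_fixes_support m d N p i (sigma i)); auto.
      rewrite htr by assumption; rewrite Nat.eqb_refl; reflexivity.
  - rewrite <- Re_Csum, <- trace_Msum, (trace_ext n _ idm), trace_idm; [reflexivity|].
    apply effect_complete; assumption.
Qed.

Theorem theorem2 (m : nat) (d : nat -> nat) (N : nat) (sigma : nat -> Mat) :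
  (1 <= m)%nat ->
  (forall k, (k < m)%nat -> (1 <= d k)%nat) ->
  (1 <= N)%nat ->
  (forall i, (i < N)%nat -> density (dimH m d) (sigma i)) ->
  (forall i j, (i < N)%nat -> (j < N)%nat -> i <> j ->
     trace (dimH m d) (mmul (dimH m d) (sigma i) (sigma j)) = C0) ->
  LOCC_distinguishable m d N sigma ->
  (forall (psi : nat -> Vec) (r e g : nat -> R),
     (forall i, (i < N)%nat ->
        unitv (dimH m d) (psi i) /\ in_support (dimH m d) (sigma i) (psi i) /\
        is_R m d (psi i) (r i) /\ is_ER m d (psi i) (e i) /\ is_Eg m d (psi i) (g i)) ->
     bounds m d N r e g) /\
  (forall (Psi : nat -> Vec) (r e g : nat -> R),
     (forall i, (i < N)%nat ->
        unitv (dimH m d) (Psi i) /\ in_support (dimH m d) (sigma i) (Psi i) /\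
        is_R m d (Psi i) (r i) /\ is_ER m d (Psi i) (e i) /\ is_Eg m d (Psi i) (g i) /\
        (forall (psi : Vec) (r' : R), unitv (dimH m d) psi ->
           in_support (dimH m d) (sigma i) psi -> is_R m d psi r' -> r' <= r i)) ->
     bounds m d N r e g).
Proof.
  intros _ hd hN hs _ hL.
  enough (main : forall (psi : nat -> Vec) (r e g : nat -> R),
     (forall i, (i < N)%nat ->
        unitv (dimH m d) (psi i) /\ in_support (dimH m d) (sigma i) (psi i) /\
        is_R m d (psi i) (r i) /\ is_ER m d (psi i) (e i) /\ is_Eg m d (psi i) (g i)) ->
     bounds m d N r e g).
  { split; [exact main|]; intros Psi r e g h; apply (main Psi); intros i hi.
    destruct (h i hi) as [? [? [? [? [? _]]]]]; auto. }
  intros psi r e g h.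
  assert (pr : forall i, (i < N)%nat -> 0 <= r i).
  { intros i hi; destruct (h i hi) as [_ [_ [[[pr _] _] _]]]; exact pr. }
  apply bounds_of_pointwise; [exact hN|exact pr|..].
  - apply (robustness_sum_le m d N sigma psi); try assumption.
    intros i hi; destruct (h i hi) as [? [? [? _]]]; auto.
  - intros i hi; destruct (h i hi) as [hu [_ [hR [hE _]]]]; specialize (pr i hi).
    rewrite <- (Rpower_2_log2 (1 + r i)) by lra; apply Rle_Rpower; [lra|].
    apply (ER_le_log_robustness m d (psi i)); assumption.
  - intros i hi; destruct (h i hi) as [hu [_ [_ [hE hG]]]].
    apply (Eg_le_ER m d (psi i)); assumption.
Qed.
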